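(* Let $X$ be a quasi-Banach space such that $X^*$ has cotype two, and let $0<p<1$. Then there is a constant $C=C(p,X)$, depending only on $p$ and $X$, such that the following holds. Suppose $\Omega$ is a compact Hausdorff space, $\mu$ is a $\sigma$-finite measure on $\Omega$, and $T:X\to L_p(\mu)$ is a strongly approximable bounded linear operator. Then there exists $v\ge0$ with $\int v^t\,d\mu\le C$, where $1/t=1/p-1/2$, such that $\|v^{-1}Tx\|_{L_2(\mu)}\le C\|T\|\,\|x\|$ for all $x\in X$.
   Context: For a quasi-Banach space $X$, the dual $X^*$ is the Banach space of bounded linear functionals on $X$ (it need not separate the points of $X$ and may be $\{0\}$). A quasi-Banach space $Z$ has cotype two if there is a constant $C$ so that for all $n$ and all $z_1,\dots,z_n\in Z$, $\bigl(\sum_{i=1}^n\|z_i\|^2\bigr)^{1/2}\le C\,\mathrm{Ave}_{\epsilon_i=\pm1}\bigl\|\sum_{i=1}^n\epsilon_iz_i\bigr\|$. For quasi-Banach spaces $X,Y$, let $\mathcal L(X,Y)$ be the space of bounded linear operators; $T:X\to Y$ is strongly approximable if it belongs to the smallest subspace $\mathcal A$ of $\mathcal L(X,Y)$ which contains the finite-rank operators and is closed under the pointwise convergence of uniformly bounded nets. The function $v$ is measurable; in $v^{-1}Tx$ the convention is $0^{-1}\cdot0=0$ and $0^{-1}\cdot a=\infty$ in absolute value for $a\neq0$ (so the conclusion includes that $Tx=0$ $\mu$-a.e. on $\{v=0\}$). *)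

(* Defs.v *)
From HB Require Import structures.
From mathcomp Require Import all_boot all_order all_algebra complex ring lra.
From mathcomp Require Import all_classical all_reals all_analysis.
From mathcomp Require Import measurable_realfun.

Set Implicit Arguments.
Unset Strict Implicit.
Unset Printing Implicit Defensive.
Import Order.TTheory GRing.Theory Num.Theory.
Import numFieldNormedType.Exports.

Local Open Scope classical_set_scope.
Local Open Scope ring_scope.

(* Everything is set up simultaneously over the real and the complex numbers. *)
Inductive scalar_field := RealScalars | ComplexScalars.

Definition scalars (R : realType) (k : scalar_field) : numFieldType :=
  match k with RealScalars => R | ComplexScalars => R[i] end.

Section scalars.
Variables (R : realType) (k : scalar_field).

Definition re_part : scalars R k -> R :=
  match k with RealScalars => id | ComplexScalars => @complex.Re R end.

Definition im_part : scalars R k -> R :=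
  match k with RealScalars => fun=> 0 | ComplexScalars => @complex.Im R end.

(* The library norm of a scalar is itself a (real) scalar. *)
Definition modulus (z : scalars R k) : R := re_part `|z|.

Definition of_real : R -> scalars R k :=
  match k with RealScalars => id | ComplexScalars => fun r => r%:C%C end.

End scalars.

Arguments re_part {R k}.
Arguments im_part {R k}.

Section scalar_theory.
Variables (R : realType) (k : scalar_field).
Implicit Types z w : scalars R k.

Lemma re_partD z w : re_part (z + w) = re_part z + re_part w.
Proof. by case: k z w => //= -[a b] [c d]. Qed.

Lemma im_partD z w : im_part (z + w) = im_part z + im_part w.
Proof. by case: k z w => //= [*|[a b] [c d]//]; rewrite addr0. Qed.

Lemma re_partM z w :
  re_part (z * w) = re_part z * re_part w - im_part z * im_part w.
Proof. by case: k z w => //= [*|[a b] [c d]//]; rewrite mulr0 subr0. Qed.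

Lemma im_partM z w :
  im_part (z * w) = re_part z * im_part w + im_part z * re_part w.
Proof. by case: k z w => //= [*|[a b] [c d]//]; rewrite mulr0 mul0r addr0. Qed.

Lemma modulusE z : modulus z = Num.sqrt (re_part z ^+ 2 + im_part z ^+ 2).
Proof.
rewrite /modulus; case: k z => /= [z|[a b]].
  by rewrite expr0n/= addr0 sqrtr_sqr.
exact: (congr1 (@complex.Re R) (normc_def (Complex a b))).
Qed.

Lemma modulus_ge0 z : 0 <= modulus z.
Proof. by rewrite modulusE sqrtr_ge0. Qed.

Lemma modulusM z w : modulus (z * w) = modulus z * modulus w.
Proof.
rewrite !modulusE -sqrtrM ?addr_ge0 ?sqr_ge0// re_partM im_partM.
congr Num.sqrt.
by rewrite mulrDl !mulrDr -!exprMn !sqrrD !sqrrN; ring.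
Qed.

Lemma modulusD z w : modulus (z + w) <= modulus z + modulus w.
Proof.
rewrite /modulus; case: k z w => /= z w; first exact: ler_normD.
have : `|z + w| <= `|z| + `|w| by exact: ler_normD.
by rewrite lecE => /andP[_]; rewrite raddfD.
Qed.

Lemma scalarP z w : re_part z = re_part w -> im_part z = im_part w -> z = w.
Proof. by case: k z w => //= -[a b] [c d] /= -> ->. Qed.

Lemma modulus_eq0 z : modulus z = 0 -> z = 0.
Proof.
rewrite modulusE => /eqP; rewrite sqrtr_eq0 => h.
have : re_part z ^+ 2 + im_part z ^+ 2 == 0.
  by rewrite eq_le h addr_ge0 ?sqr_ge0.
rewrite paddr_eq0 ?sqr_ge0// !sqrf_eq0 => /andP[/eqP z1 /eqP z2].
by apply: scalarP; [rewrite z1|rewrite z2]; case: k.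
Qed.

Lemma modulus0 : modulus (0 : scalars R k) = 0.
Proof. by rewrite /modulus normr0; case: k. Qed.

Lemma modulus1 : modulus (1 : scalars R k) = 1.
Proof. by rewrite /modulus normr1; case: k. Qed.

Lemma modulus_of_real (r : R) : modulus (of_real k r) = `|r|.
Proof.
by rewrite modulusE; case: k => /=; rewrite expr0n/= addr0 sqrtr_sqr.
Qed.

End scalar_theory.

HB.mixin Record Lmodule_isQuasiNormed (R : realType) (k : scalar_field)
    (V : Type) of GRing.Lmodule (scalars R k) V := {
  qnorm : V -> R ;
  qnorm_ge0 : forall x, 0 <= qnorm x ;
  qnorm_eq0 : forall x, qnorm x = 0 -> x = 0 ;
  qnormZ : forall (a : scalars R k) x, qnorm (a *: x) = modulus a * qnorm x ;
  qnormD : exists C : R, forall x y, qnorm (x + y) <= C * (qnorm x + qnorm y)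
}.

#[short(type="quasiNormedModType")]
HB.structure Definition QuasiNormedModule (R : realType) (k : scalar_field) :=
  {V of GRing.Lmodule (scalars R k) V & Lmodule_isQuasiNormed R k V}.

HB.mixin Record QuasiNormed_isQuasiBanach (R : realType) (k : scalar_field)
    (V : Type) of QuasiNormedModule R k V := {
  qnorm_complete : forall u : nat -> V,
    (forall e : R, 0 < e -> exists N, forall m n,
        (N <= m)%N -> (N <= n)%N -> qnorm (u m - u n) < e) ->
    exists l : V, forall e : R, 0 < e -> exists N, forall n,
        (N <= n)%N -> qnorm (u n - l) < e
}.

#[short(type="quasiBanachType")]
HB.structure Definition QuasiBanach (R : realType) (k : scalar_field) :=
  {V of QuasiNormedModule R k V & QuasiNormed_isQuasiBanach R k V}.

Section quasi_normed_theory.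
Variables (R : realType) (k : scalar_field) (V : quasiNormedModType R k).

Lemma qnorm0 : qnorm (0 : V) = 0.
Proof. by rewrite -(scale0r (0 : V)) qnormZ modulus0 mul0r. Qed.

Lemma qnormD_ge0 : exists2 C : R, 0 <= C &
  forall x y : V, qnorm (x + y) <= C * (qnorm x + qnorm y).
Proof.
have [C hC] := @qnormD R k V; exists `|C| => // x y.
by rewrite (le_trans (hC x y))// ler_wpM2r ?ler_norm// addr_ge0// qnorm_ge0.
Qed.

End quasi_normed_theory.

Section scalar_quasi_normed.
Variables (R : realType) (k : scalar_field).

Let modulusD_ex : exists C : R, forall z w : (scalars R k)^o,
  modulus (z + w) <= C * (modulus z + modulus w).
Proof. by exists 1 => z w; rewrite mul1r modulusD. Qed.

HB.instance Definition _ := Lmodule_isQuasiNormed.Build R k (scalars R k)^o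
  (@modulus_ge0 R k) (@modulus_eq0 R k) (@modulusM R k) modulusD_ex.

End scalar_quasi_normed.

Section bounded_operators.
Variables (R : realType) (k : scalar_field) (X Y : quasiNormedModType R k).

Definition bounded_linear : {pred X -> Y} := fun f =>
  `[< linear f /\ exists M : R, forall x, qnorm (f x) <= M * qnorm x >].

Lemma bounded_linearP f : reflect
  (linear f /\ exists M : R, forall x, qnorm (f x) <= M * qnorm x)
  (f \in bounded_linear).
Proof. exact: asboolP. Qed.

Lemma bounded_linear_ge0 f : f \in bounded_linear ->
  exists2 M : R, 0 <= M & forall x, qnorm (f x) <= M * qnorm x.
Proof.
move=> /bounded_linearP[_ [M hM]]; exists `|M| => // x.
by rewrite (le_trans (hM x))// ler_wpM2r ?qnorm_ge0 ?ler_norm.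
Qed.

Lemma bounded_linear_submod : submod_closed bounded_linear.
Proof.
split.
  apply/bounded_linearP; split.
    by move=> a x y /=; rewrite scaler0 addr0.
  by exists 0 => x; rewrite [X in qnorm X]/= qnorm0 mul0r.
move=> a f g /[dup] /bounded_linearP[lf _] /bounded_linear_ge0[M M0 hM].
move=> /[dup] /bounded_linearP[lg _] /bounded_linear_ge0[N N0 hN].
apply/bounded_linearP; split.
  move=> b x y; rewrite !fctE lf lg !scalerDr !scalerA (mulrC a b).
  by rewrite addrACA.
have [C C0 hC] := @qnormD_ge0 _ _ Y.
exists (C * (modulus a * M + N)) => x; rewrite fctE.
rewrite (le_trans (hC _ _))// -mulrA ler_wpM2l// mulrDl lerD//.
by rewrite qnormZ -mulrA ler_wpM2l// modulus_ge0.
Qed.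

HB.instance Definition _ := GRing.isSubmodClosed.Build (scalars R k) (X -> Y)
  bounded_linear bounded_linear_submod.

Record bounded_op := BoundedOp {
  bounded_op_fun :> X -> Y ;
  _ : bounded_op_fun \in bounded_linear }.

HB.instance Definition _ := [isSub for bounded_op_fun].
HB.instance Definition _ := [Choice of bounded_op by <:].
HB.instance Definition _ := [SubChoice_isSubLmodule of bounded_op by <:].

Implicit Types T S : bounded_op.

Lemma bounded_op_linear T : linear T.
Proof. by have /bounded_linearP[] := valP T. Qed.

HB.instance Definition _ T :=
  GRing.isLinear.Build (scalars R k) X Y *:%R T (@bounded_op_linear T).

Definition opnorm T : R := sup [set qnorm (T x) | x in [set x | qnorm x <= 1]].

Let unit_ball_image T := [set qnorm (T x) | x in [set x | qnorm x <= 1]].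

Let has_sup_opnorm T : has_sup (unit_ball_image T).
Proof.
split; first by exists (qnorm (T 0)), 0 => //=; rewrite qnorm0.
have [M M0 hM] := bounded_linear_ge0 (valP T).
exists M => _ [x /= x1 <-].
by rewrite (le_trans (hM x))// ler_piMr.
Qed.

Lemma opnorm_ub T x : qnorm x <= 1 -> qnorm (T x) <= opnorm T.
Proof.
by move=> x1; apply: ub_le_sup; [exact: (has_sup_opnorm T).2|exists x].
Qed.

Lemma opnorm_le T (M : R) :
  (forall x, qnorm x <= 1 -> qnorm (T x) <= M) -> opnorm T <= M.
Proof.
move=> h; apply: ge_sup; first exact: (has_sup_opnorm T).1.
by move=> _ [x x1 <-]; exact: h.
Qed.

Lemma opnorm_ge0 T : 0 <= opnorm T.
Proof.
by rewrite (le_trans (qnorm_ge0 (T 0)))// opnorm_ub// qnorm0.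
Qed.

Lemma opnormP T x : qnorm (T x) <= opnorm T * qnorm x.
Proof.
have [x0|x0] := eqVneq (qnorm x) 0.
  by rewrite (qnorm_eq0 _ x0) linear0 !qnorm0 mulr0.
have xgt0 : 0 < qnorm x by rewrite lt_neqAle eq_sym x0 qnorm_ge0.
rewrite -ler_pdivrMr// mulrC.
have -> : (qnorm x)^-1 * qnorm (T x) = qnorm (T (of_real k (qnorm x)^-1 *: x)).
  by rewrite linearZ qnormZ modulus_of_real ger0_norm ?invr_ge0 ?qnorm_ge0.
apply: opnorm_ub.
by rewrite qnormZ modulus_of_real ger0_norm ?invr_ge0 ?qnorm_ge0// mulVf.
Qed.

Lemma opnorm_eq0 T : opnorm T = 0 -> T = 0.
Proof.
move=> T0; apply/val_inj/funext => x /=; apply: qnorm_eq0; apply/eqP.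
by rewrite eq_le qnorm_ge0 andbT (le_trans (opnormP T x))// T0 mul0r.
Qed.

Let opnormZ_le (a : scalars R k) T : opnorm (a *: T) <= modulus a * opnorm T.
Proof.
apply: opnorm_le => x x1.
by rewrite [X in qnorm X]/= qnormZ ler_wpM2l ?modulus_ge0// opnorm_ub.
Qed.

Lemma opnormZ (a : scalars R k) T : opnorm (a *: T) = modulus a * opnorm T.
Proof.
apply/eqP; rewrite eq_le opnormZ_le/=.
have [->|a0] := eqVneq a 0; first by rewrite modulus0 mul0r opnorm_ge0.
rewrite -{1}(scale1r T) -(mulVf a0) -scalerA.
rewrite (le_trans (ler_wpM2l (modulus_ge0 a) (opnormZ_le _ _)))//.
by rewrite mulrA -modulusM mulfV// modulus1 mul1r.
Qed.

Lemma opnormD : exists C : R, forall T S,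
  opnorm (T + S) <= C * (opnorm T + opnorm S).
Proof.
have [C C0 hC] := @qnormD_ge0 _ _ Y; exists C => T S.
apply: opnorm_le => x x1; rewrite (le_trans (hC _ _))// ler_wpM2l//.
by rewrite lerD ?opnorm_ub.
Qed.

HB.instance Definition _ := Lmodule_isQuasiNormed.Build R k bounded_op
  opnorm_ge0 opnorm_eq0 opnormZ opnormD.

End bounded_operators.

Definition dual_space (R : realType) (k : scalar_field)
    (X : quasiNormedModType R k) :=
  bounded_op X (scalars R k)^o.

Definition cotype_two (R : realType) (k : scalar_field)
    (Z : quasiNormedModType R k) :=
  exists C : R, forall (n : nat) (z : 'I_n -> Z),
    Num.sqrt (\sum_i qnorm (z i) ^+ 2) <=
    C * ((2 ^ n)%:R^-1 *
         \sum_(e : {ffun 'I_n -> bool}) qnorm (\sum_i (-1) ^+ e i *: z i)).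

Section strongly_approximable.
Variables (R : realType) (k : scalar_field) (X Y : quasiNormedModType R k).
Implicit Types (A : set (bounded_op X Y)) (T : bounded_op X Y).

Definition finite_rank T := exists (n : nat) (y : 'I_n -> Y),
  forall x, exists c : 'I_n -> scalars R k, T x = \sum_i c i *: y i.

Definition is_subspace A := A 0 /\
  forall (a : scalars R k) S T, A S -> A T -> A (a *: S + T).

Definition directed (I : Type) (le : I -> I -> Prop) :=
  [/\ inhabited I, forall i, le i i,
      forall i j l, le i j -> le j l -> le i l &
      forall i j, exists l, le i l /\ le j l].

Definition pointwise_cvg_net (I : Type) (le : I -> I -> Prop)
    (S : I -> bounded_op X Y) T :=
  forall (x : X) (e : R), 0 < e ->
    exists i0, forall i, le i0 i -> qnorm (S i x - T x) < e.

Definition bounded_net_closed A :=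
  forall (I : Type) (le : I -> I -> Prop) (S : I -> bounded_op X Y) T,
    directed le -> (forall i, A (S i)) ->
    (exists M : R, forall i, qnorm (S i) <= M) ->
    pointwise_cvg_net le S T -> A T.

Definition strongly_approximable : set (bounded_op X Y) :=
  smallest [set A | is_subspace A /\ bounded_net_closed A] finite_rank.

End strongly_approximable.

Section Lp_functions.
Context d (T : measurableType d) (R : realType) (k : scalar_field).
Variables (mu : {measure set T -> \bar R}) (p : R).
Implicit Types f g : T -> (scalars R k)^o.

Definition scalar_measurable f :=
  measurable_fun setT (re_part \o f) /\
  measurable_fun setT (im_part \o f).

Definition Lp_norm f : \bar R := 'N[mu]_p%:E[(fun x => (modulus (f x))%:E)]%E.

(* The proof of 0 < p is an argument because Lp_pred is only a subspace then. *)
Definition Lp_pred (p0 : 0 < p) : {pred T -> (scalars R k)^o} := fun f =>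
  `[< scalar_measurable f /\ (Lp_norm f < +oo)%E >].

Lemma Lp_predP (p0 : 0 < p) f :
  reflect (scalar_measurable f /\ (Lp_norm f < +oo)%E) (f \in Lp_pred p0).
Proof. exact: asboolP. Qed.

Lemma measurable_modulus f : scalar_measurable f ->
  measurable_fun setT (fun x => modulus (f x)).
Proof.
move=> [mr mi].
rewrite (_ : (fun _ => _) = Num.sqrt \o
    ((fun x => (re_part \o f) x ^+ 2) \+ (fun x => (im_part \o f) x ^+ 2))).
  apply: measurableT_comp.
    by apply: continuous_measurable_fun; exact: sqrt_continuous.
  by apply: measurable_funD; exact: measurable_funX.
by apply/funext => x /=; rewrite modulusE.
Qed.

Lemma scalar_measurable_submod (a : scalars R k) f g :
  scalar_measurable f -> scalar_measurable g -> scalar_measurable (a *: f + g).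
Proof.
move=> [fr fi] [gr gi]; split.
  rewrite (_ : _ \o _ = ((cst (re_part a) \* (re_part \o f)) \-
      (cst (im_part a) \* (im_part \o f))) \+ (re_part \o g)).
    by apply: measurable_funD => //; apply: measurable_funB;
       exact: measurable_funM.
  by apply/funext => x; rewrite /= re_partD re_partM.
rewrite (_ : _ \o _ = ((cst (re_part a) \* (im_part \o f)) \+
    (cst (im_part a) \* (re_part \o f))) \+ (im_part \o g)).
  by apply: measurable_funD => //; apply: measurable_funD;
     exact: measurable_funM.
by apply/funext => x; rewrite /= im_partD im_partM.
Qed.

Lemma Lp_norm_int f : Lp_norm f =
  ((\int[mu]_x (modulus (f x) `^ p)%:E) `^ p^-1)%E.
Proof.
rewrite /Lp_norm Lnorm.unlock; congr poweR.
by apply: eq_integral => x _ /=; rewrite ger0_norm ?modulus_ge0.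
Qed.

End Lp_functions.

Section Lp_quotient.
Context d (T : measurableType d) (R : realType) (k : scalar_field).
Variables (mu : {measure set T -> \bar R}) (p : R) (p0 : 0 < p).
Implicit Types f g : T -> (scalars R k)^o.

Local Notation Lint f := (\int[mu]_x (modulus (f x) `^ p)%:E)%E.

Let Lint_ge0 f : (0 <= Lint f)%E.
Proof. by apply: integral_ge0 => x _; rewrite lee_fin powR_ge0. Qed.

Let measurable_powmod f : scalar_measurable f ->
  measurable_fun setT (fun x => (modulus (f x) `^ p)%:E).
Proof.
move=> mf; apply/measurable_EFinP.
apply: (measurableT_comp (measurable_powR _)).
exact: measurable_modulus.
Qed.

Let LintZ (a : scalars R k) f : scalar_measurable f ->
  Lint (a *: f) = ((modulus a `^ p)%:E * Lint f)%E.
Proof.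
move=> mf; rewrite -ge0_integralZl//; last 3 first.
- exact: measurable_powmod.
- by move=> x _; rewrite lee_fin powR_ge0.
- by rewrite lee_fin powR_ge0.
apply: eq_integral => x _; rewrite -EFinM -powRM ?modulus_ge0//.
by rewrite fctE modulusM.
Qed.

Let LintD f g : scalar_measurable f -> scalar_measurable g ->
  (Lint (f + g) <= (2 `^ p)%:E * (Lint f + Lint g))%E.
Proof.
move=> mf mg.
have mfg : scalar_measurable (f + g).
  by rewrite -(scale1r f); exact: scalar_measurable_submod.
rewrite -ge0_integralD//; last 4 first.
- by move=> x _; rewrite lee_fin powR_ge0.
- exact: measurable_powmod.
- by move=> x _; rewrite lee_fin powR_ge0.
- exact: measurable_powmod.
have mS : measurable_fun setT
    (fun x => (modulus (f x) `^ p)%:E + (modulus (g x) `^ p)%:E)%E.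
  by apply: (@emeasurable_funD _ _ _ _ (fun x => (modulus (f x) `^ p)%:E)
    (fun x => (modulus (g x) `^ p)%:E)); exact: measurable_powmod.
rewrite -ge0_integralZl//; last first.
  by move=> x _; rewrite adde_ge0// lee_fin powR_ge0.
apply: ge0_le_integral => //.
- by move=> x _; rewrite lee_fin powR_ge0.
- exact: measurable_powmod.
- exact: measurable_funeM.
move=> x _; rewrite lee_fin fctE.
have a0 := modulus_ge0 (f x); have b0 := modulus_ge0 (g x).
apply: (@le_trans _ _ ((2 * Num.max (modulus (f x)) (modulus (g x))) `^ p)).
  apply: ge0_ler_powR; rewrite ?nnegrE ?modulus_ge0 ?(ltW p0)//.
    by rewrite mulr_ge0// le_max a0.
  rewrite (le_trans (modulusD _ _))// mulrDl !mul1r lerD// le_max lexx ?orbT//.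
rewrite powRM ?le_max ?a0// ler_wpM2l ?powR_ge0//.
by case: (leP (modulus (f x))) => _; [rewrite lerDr|rewrite lerDl];
  rewrite powR_ge0.
Qed.

Let Lp_norm_lty f : ((Lp_norm mu p f < +oo) <-> (Lint f < +oo))%E.
Proof.
rewrite Lp_norm_int; split; last exact: poweR_lty.
by apply: lty_poweRy; rewrite invr_neq0// gt_eqF.
Qed.

Lemma Lp_submod : submod_closed (@Lp_pred _ T R k mu p p0).
Proof.
split.
  apply/Lp_predP; split.
    by split; [rewrite (_ : _ \o _ = cst 0)//|rewrite (_ : _ \o _ = cst 0)//];
      apply/funext => x /=; case: k.
  apply/Lp_norm_lty; under eq_integral.
    by move=> x _; rewrite [X in modulus X]/= modulus0 powR0 ?gt_eqF//; over.
  by rewrite integral0.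
move=> a f g /Lp_predP[mf /Lp_norm_lty If] /Lp_predP[mg /Lp_norm_lty Ig].
apply/Lp_predP; split; first exact: scalar_measurable_submod.
have maf : scalar_measurable (a *: f).
  rewrite -(addr0 (a *: f)); apply: scalar_measurable_submod => //.
  by split; [rewrite (_ : _ \o _ = cst 0)//|rewrite (_ : _ \o _ = cst 0)//];
    apply/funext => x /=; case: k.
apply/Lp_norm_lty; rewrite (le_lt_trans (LintD maf mg))// LintZ//.
rewrite lte_mul_pinfty ?lee_fin ?powR_ge0// lte_add_pinfty//.
apply: lte_mul_pinfty => //; by rewrite lee_fin powR_ge0.
Qed.

HB.instance Definition _ := GRing.isSubmodClosed.Build (scalars R k)
  (T -> (scalars R k)^o) (@Lp_pred _ T R k mu p p0) Lp_submod.

Record Lp_fun := LpFun {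
  Lp_fun_fun :> T -> (scalars R k)^o ;
  _ : Lp_fun_fun \in @Lp_pred _ T R k mu p p0 }.

HB.instance Definition _ := [isSub for Lp_fun_fun].
HB.instance Definition _ := [Choice of Lp_fun by <:].
HB.instance Definition _ := [SubChoice_isSubLmodule of Lp_fun by <:].

Definition Lp_null : {pred Lp_fun} := fun u : Lp_fun =>
  `[< {ae mu, forall x, u x = 0} >].

Lemma Lp_nullP (u : Lp_fun) :
  reflect {ae mu, forall x, u x = 0} (u \in Lp_null).
Proof. exact: asboolP. Qed.

Lemma Lp_null_submod : submod_closed Lp_null.
Proof.
split; first by apply/Lp_nullP/aeW.
move=> a u w /Lp_nullP u0 /Lp_nullP w0; apply/Lp_nullP.
apply: filterS2 u0 w0 => x ux wx.
rewrite (_ : (a *: u + w) x = a *: u x + w x)// ux wx scaler0 addr0//.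
Qed.

HB.instance Definition _ := GRing.isSubmodClosed.Build (scalars R k)
  Lp_fun Lp_null Lp_null_submod.

Local Open Scope quotient_scope.

Definition Lp_space : Type := Quotient.quot (Lp_null : zmodClosed Lp_fun).

HB.instance Definition _ := GRing.Zmodule.on Lp_space.
HB.instance Definition _ := Choice.on Lp_space.

Definition Lp_class (u : Lp_fun) : Lp_space :=
  \pi_(Quotient.quot (Lp_null : zmodClosed Lp_fun)) u.

Definition Lp_repr (q : Lp_space) : Lp_fun :=
  @repr _ (Quotient.quot (Lp_null : zmodClosed Lp_fun)) q.

Coercion Lp_repr : Lp_space >-> Lp_fun.

Lemma Lp_reprK q : Lp_class (Lp_repr q) = q.
Proof. exact: reprK. Qed.

Lemma Lp_classB (u w : Lp_fun) :
  (u - w \in Lp_null) = (Lp_class u == Lp_class w).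
Proof. exact: Quotient.idealrBE. Qed.

Lemma Lp_classP (u w : Lp_fun) :
  Lp_class u = Lp_class w <-> {ae mu, forall x, u x = w x}.
Proof.
split=> [/eqP|uw].
  rewrite -Lp_classB => /Lp_nullP; apply: filterS => x uwx.
  by apply/eqP; rewrite -subr_eq0; apply/eqP.
apply/eqP; rewrite -Lp_classB; apply/Lp_nullP.
apply: filterS uw => x ux.
by rewrite (_ : (u - w) x = u x - w x)// ux subrr.
Qed.

Lemma Lp_class_repr (u : Lp_fun) :
  {ae mu, forall x, Lp_repr (Lp_class u) x = u x}.
Proof. by apply/Lp_classP; rewrite Lp_reprK. Qed.

Lemma Lp_classD : {morph Lp_class : u w / u + w}.
Proof. exact: Quotient.pi_add. Qed.

Lemma Lp_class0 : Lp_class 0 = 0.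
Proof. by apply: (addrI (Lp_class 0)); rewrite -Lp_classD !addr0. Qed.

Definition Lp_space_scale (a : scalars R k) (q : Lp_space) : Lp_space :=
  Lp_class (a *: Lp_repr q).

Lemma Lp_classZ (a : scalars R k) (u : Lp_fun) :
  Lp_class (a *: u) = Lp_space_scale a (Lp_class u).
Proof.
apply/eqP; rewrite -Lp_classB -scalerBr.
by apply: rpredZ; rewrite Lp_classB Lp_reprK.
Qed.

Let scaleA a b q :
  Lp_space_scale a (Lp_space_scale b q) = Lp_space_scale (a * b) q.
Proof. by rewrite -Lp_classZ scalerA. Qed.

Let scale1 : left_id 1 Lp_space_scale.
Proof. by move=> q; rewrite /Lp_space_scale scale1r Lp_reprK. Qed.

Let scaleDr : right_distributive Lp_space_scale +%R.
Proof.
move=> a q r; rewrite -{1}(Lp_reprK q) -{1}(Lp_reprK r) -Lp_classD -Lp_classZ.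
by rewrite scalerDr Lp_classD.
Qed.

Let scaleDl q : {morph Lp_space_scale^~ q : a b / a + b}.
Proof. by move=> a b; rewrite /Lp_space_scale scalerDl Lp_classD. Qed.

HB.instance Definition _ := GRing.Zmodule_isLmodule.Build (scalars R k) Lp_space
  scaleA scale1 scaleDr scaleDl.

Definition Lp_space_norm (q : Lp_space) : R := fine (Lp_norm mu p (Lp_repr q)).

Let I (u : Lp_fun) : R := fine (Lint u).

Let Iint (u : Lp_fun) : (I u)%:E = Lint u.
Proof.
have /Lp_predP[_ /Lp_norm_lty u_lty] := valP u.
by rewrite fineK// ge0_fin_numE.
Qed.

Let I_ge0 u : 0 <= I u.
Proof. by rewrite -lee_fin Iint. Qed.

Let I_ae (u w : Lp_fun) : {ae mu, forall x, u x = w x} -> I u = I w.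
Proof.
move=> uw; congr fine; apply: ge0_ae_eq_integral => //.
- by apply: measurable_powmod; have /Lp_predP[] := valP u.
- by apply: measurable_powmod; have /Lp_predP[] := valP w.
- by move=> x _; rewrite lee_fin powR_ge0.
- by move=> x _; rewrite lee_fin powR_ge0.
- by apply: filterS uw => x ->.
Qed.

Let normE q : Lp_space_norm q = I (Lp_repr q) `^ p^-1.
Proof. by rewrite /Lp_space_norm Lp_norm_int -Iint. Qed.

Let norm_class u : Lp_space_norm (Lp_class u) = I u `^ p^-1.
Proof. by rewrite normE (I_ae (Lp_class_repr u)). Qed.

Let norm_ge0 q : 0 <= Lp_space_norm q.
Proof. by rewrite normE powR_ge0. Qed.

Let norm_eq0 q : Lp_space_norm q = 0 -> q = 0.
Proof.
have /Lp_predP[mq q_lty] := valP (Lp_repr q).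
rewrite /Lp_space_norm => q0.
have : Lp_norm mu p (Lp_repr q) = 0%E.
  by rewrite -[LHS]fineK ?q0// ge0_fin_numE// Lnorm_ge0.
move=> /Lnorm_eq0_eq0 => /(_ _ _)/= => h.
rewrite -(Lp_reprK q) -Lp_class0; apply: (Lp_classP _ _).2.
have mm : measurable_fun setT (fun x => (modulus (Lp_repr q x))%:E).
  by apply/measurable_EFinP; exact: measurable_modulus.
apply: filterS (h mm _) => [x /(_ Logic.I)/= []|]; last by rewrite lte_fin.
exact: modulus_eq0.
Qed.

Let normZ (a : scalars R k) q :
  Lp_space_norm (a *: q) = modulus a * Lp_space_norm q.
Proof.
have mq : scalar_measurable (Lp_repr q) by have /Lp_predP[] := valP (Lp_repr q).
rewrite [LHS]norm_class normE.
have -> : I (a *: Lp_repr q) = modulus a `^ p * I (Lp_repr q).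
  by rewrite /I [X in fine X](LintZ a mq) -Iint.
by rewrite powRM ?powR_ge0// -powRrM mulfV ?gt_eqF// powRr1 ?modulus_ge0.
Qed.

Let normD : exists C : R, forall q r,
  Lp_space_norm (q + r) <= C * (Lp_space_norm q + Lp_space_norm r).
Proof.
exists ((2 `^ p * 2) `^ p^-1) => q r.
have mq : scalar_measurable (Lp_repr q) by have /Lp_predP[] := valP (Lp_repr q).
have mr : scalar_measurable (Lp_repr r) by have /Lp_predP[] := valP (Lp_repr r).
rewrite -{1}(Lp_reprK q) -{1}(Lp_reprK r) -Lp_classD norm_class !normE.
have : I (Lp_repr q + Lp_repr r) <= 2 `^ p * (I (Lp_repr q) + I (Lp_repr r)).
  have fineD (c a b e : R) (A B E : \bar R) : a%:E = A -> b%:E = B ->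
      e%:E = E -> (E <= c%:E * (A + B))%E -> e <= c * (a + b).
    by move=> <- <- <-; rewrite -EFinD -EFinM lee_fin.
  by apply: fineD (LintD mq mr); exact: Iint.
move: (I_ge0 (Lp_repr q)) (I_ge0 (Lp_repr r)) (I_ge0 (Lp_repr q + Lp_repr r)).
move: (I (Lp_repr q)) (I (Lp_repr r)) (I (_ + _)) => A B D A0 B0 D0 DAB.
have p'0 : 0 <= p^-1 by rewrite invr_ge0 ltW.
have M0 : 0 <= Num.max A B by rewrite le_max A0.
apply: (@le_trans _ _ ((2 `^ p * 2 * Num.max A B) `^ p^-1)).
  apply: ge0_ler_powR; rewrite ?nnegrE ?mulr_ge0 ?powR_ge0//.
  rewrite (le_trans DAB)// -mulrA ler_wpM2l ?powR_ge0//.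
  by rewrite mulrDl !mul1r lerD// le_max lexx ?orbT.
rewrite powRM ?mulr_ge0 ?powR_ge0// ler_wpM2l ?powR_ge0//.
by case: (leP A) => _; [rewrite lerDr|rewrite lerDl]; rewrite powR_ge0.
Qed.

HB.instance Definition _ := Lmodule_isQuasiNormed.Build R k Lp_space
  norm_ge0 norm_eq0 normZ normD.

End Lp_quotient.

Arguments Lp_space {d T R} k mu {p} p0.

Notation borel Omega := (g_sigma_algebraType (@open Omega)).

(* The extended-real conventions of the library, 0^-1 = +oo and +oo * 0 = 0,
   make this 0 where v and f both vanish and +oo where only v vanishes. *)
Definition weighted_abs (T : Type) (R : realType) (k : scalar_field)
    (v : T -> R) (f : T -> scalars R k) : T -> \bar R :=
  fun w => ((v w)%:E^-1 * (modulus (f w))%:E)%E.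

(* Main.v *)
Require Import Defs.
From mathcomp Require Import all_boot all_order all_algebra complex ring lra.
From mathcomp Require Import all_classical all_reals all_analysis.
From mathcomp Require Import measurable_realfun.
Set Implicit Arguments.
Unset Strict Implicit.
Unset Printing Implicit Defensive.
Import Order.TTheory GRing.Theory Num.Theory.
Import numFieldNormedType.Exports.
Local Open Scope classical_set_scope.
Local Open Scope ring_scope.

(** Write N for the norm of T.  Maurey's theorem turns the conclusion into an
    inequality: a density v with the required properties exists, with constant
    c, as soon as T is two-convex with constant c, that is

      || (sum_i |T x_i|^2)^(1/2) ||_p <= c   whenever   sum_i ||x_i||^2 <= 1.

    So the theorem says that a strongly approximable T is two-convex with a
    constant which is a fixed multiple of N.

    The heart is a bootstrap: if T is two-convex with some constant c, and
    c >= B N for a suitable B depending only on p and on the cotype two constant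
    of the dual, then T is two-convex with constant c / 2.  By Maurey's theorem
    T x = w^((2-p)/p) phi_x, where w is in the unit ball of L_2 and x |-> phi_x
    is bounded by c from X to L_2.  For the density w^2, of mass at most 1, the
    operator S x = phi_x / w then has norm at most N into L_p and at most c into
    L_2, so that its norm into L_1 is a small multiple of c once c is large
    compared with N.  As L_1 is locally convex, this passes to the adjoint of S,
    with values in the dual of X: it has small norm on L_infinity and norm at
    most c on L_2.  Let g_1, ..., g_n be functions with
    sum_i |g_i|^2 <= 1.  Truncating the Rademacher sums
    G_e = sum_i e_i g_i at a large level Q, and using that their fourth moments
    are bounded, shows that the average over the signs of || S^* G_e || is at
    most of order c / Q.  Cotype two of the dual then bounds
    (sum_i ||S^* g_i||^2)^(1/2) by the same quantity, and duality against
    g_i = conj(phi_{x_i}) / (sum_j |phi_{x_j}|^2)^(1/2) gives the square function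
    inequality for S in L_1, hence for T in L_p, with constant c / 2 if Q was
    chosen large enough.  The lemmas carrying this are maurey_density,
    pairing_bound, signed_functional_norm and two_convex_half.

    Iterating, a two-convex operator, with whatever constant, is two-convex with
    any positive constant that is at least B N (two_convex_apriori).  This
    automatic bound is uniform over a bounded net, so the set of all two-convex
    operators is a subspace closed under pointwise limits of bounded nets; it
    contains the finite-rank operators because the coordinates on a
    finite-dimensional space are bounded.  Hence it contains all strongly
    approximable operators. *)

(** * Power inequalities *)

Section powers.
Variable R : realType.
Implicit Types a b x y s p A : R.

Lemma powR_le_tangent s r : 0 < s < 1 -> 0 <= r -> r `^ s <= 1 + s * (r - 1).
Proof.
move=> /andP[s0 s1] r0.
have s1' : 0 < 1 - s by rewrite subr_gt0.
have /(@conjugate_powR _ (r `^ s) 1 s^-1 (1 - s)^-1 (powR_ge0 _ _)) :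
  0 <= (1 : R) by [].
rewrite !invr_gt0 !invrK => /(_ s0 s1') h.
rewrite -(mulr1 (r `^ s)) (le_trans (h _))//; first by rewrite subrKC.
by rewrite -powRrM mulfV ?gt_eqF// powRr1// powR1; lra.
Qed.

Lemma powR_sub_ge s x y : 0 < s < 1 -> 0 <= x -> 0 < y ->
  s * (y - x) * y `^ (s - 1) <= y `^ s - x `^ s.
Proof.
move=> s01 x0 y0; have y0' := ltW y0.
have := powR_le_tangent s01 (divr_ge0 x0 y0').
have ys : 0 < y `^ s by exact: powR_gt0.
rewrite powRM ?invr_ge0// -(powR_inv1 y0') -powRrM mulN1r powRN.
rewrite ler_pdivrMr// powR_inv1// => h.
have -> : y `^ (s - 1) = y `^ s / y.
  by rewrite powRB ?powRr1//; apply/implyP => _; rewrite gt_eqF.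
suff -> : s * (y - x) * (y `^ s / y) =
  y `^ s - (1 + s * (x / y - 1)) * y `^ s by rewrite lerB.
by field; rewrite gt_eqF.
Qed.

Lemma powR_add_le s x y : 0 < s < 1 -> 0 <= x -> 0 <= y ->
  (x + y) `^ s <= x `^ s + y `^ s.
Proof.
move=> s01 x0 y0; have [xy0|xy0] := eqVneq (x + y) 0.
  by rewrite xy0 powR0 ?gt_eqF//; [rewrite addr_ge0 ?powR_ge0|lra].
have xyp : 0 < x + y by rewrite lt_neqAle eq_sym xy0 addr_ge0.
have key z : 0 <= z -> z <= x + y -> z / (x + y) * (x + y) `^ s <= z `^ s.
  move=> z0 zxy; have [->|zN0] := eqVneq z 0; first by rewrite !mul0r powR_ge0.
  have zp : 0 < z by rewrite lt_neqAle eq_sym zN0.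
  have -> : z `^ s = (z / (x + y)) `^ s * (x + y) `^ s.
    by rewrite -powRM ?divr_ge0 ?ltW// divfK.
  rewrite ler_wpM2r ?powR_ge0// ger1_powR//; last lra.
  by rewrite divr_gt0//= ler_pdivrMr// mul1r.
have hx : x <= x + y by rewrite lerDl.
have hy : y <= x + y by rewrite lerDr.
rewrite (le_trans _ (lerD (key _ x0 hx) (key _ y0 hy)))//.
by rewrite -mulrDl -mulrDl divff// mul1r.
Qed.

Lemma sum_powR_le (I : Type) (r : seq I) (F : I -> R) e : 0 < e < 1 ->
  (forall i, 0 <= F i) ->
  (\sum_(i <- r) F i) `^ e <= \sum_(i <- r) F i `^ e.
Proof.
move=> e01 F0; elim: r => [|i r IH].
  by rewrite !big_nil powR0// gt_eqF//; case/andP: e01.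
rewrite !big_cons (le_trans (powR_add_le e01 _ _))//.
  exact: sumr_ge0.
by rewrite lerD2l.
Qed.

(** The deficit in the concavity of r^s at a midpoint controls a squared
    distance, so that a sequence maximizing the integral of f^s over a convex set
    is Cauchy in the variable f^(s/2).  The restriction s <= 1/2 lets the power
    mean of exponent 1/s dominate the quadratic mean of a^s and b^s. *)
Lemma powR_midpoint s a b : 0 < s <= 2^-1 -> 0 <= a -> 0 <= b ->
  (a `^ (s / 2) - b `^ (s / 2)) ^+ 2 <=
  8 * ((2^-1 * (a + b)) `^ s - 2^-1 * (a `^ s + b `^ s)).
Proof.
move=> /andP[s0 s12] a0 b0.
set m := 2^-1 * (a + b); have m0 : 0 <= m by rewrite /m; lra.
have [mE|mN0] := eqVneq m 0.
  have -> : a = 0 by move: mE; rewrite /m; lra.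
  have -> : b = 0 by move: mE; rewrite /m; lra.
  by rewrite mE !powR0; [lra|lra|lra].
have mp : 0 < m by rewrite lt_neqAle eq_sym mN0.
have sq z : 0 <= z -> z `^ s = (z `^ (s / 2)) ^+ 2.
  by move=> z0; rewrite -powR_mulrn ?powR_ge0// -powRrM divfK.
have P2 : 2^-1 * ((a `^ s) ^+ 2 + (b `^ s) ^+ 2) <= (m `^ s) ^+ 2.
  have [->|s_lt] := eqVneq s (2^-1).
    rewrite !powR12_sqrt// !sqr_sqrtr// /m; lra.
  have s2 : 0 < s * 2 < 1 by apply/andP; split; [lra|lra].
  have key z : 0 <= z -> (z `^ s) ^+ 2 <= (1 + s * 2 * (z / m - 1)) * (m `^ s) ^+ 2.
    move=> z0; rewrite -!powR_mulrn ?powR_ge0// -!powRrM.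
    have -> : z `^ (s * 2) = (z / m) `^ (s * 2) * m `^ (s * 2).
      by rewrite -powRM ?divr_ge0// divfK.
    by rewrite ler_wpM2r ?powR_ge0// powR_le_tangent// divr_ge0.
  have := key _ a0; have := key _ b0; set Q := (m `^ s) ^+ 2.
  have -> : b / m = 2 - a / m.
    by rewrite /m; field; apply: contra_neq mN0 => h; rewrite /m h mulr0.
  by nra.
rewrite !sq// in P2 *; move: P2.
have := powR_ge0 m (s / 2); have := powR_ge0 a (s / 2).
have := powR_ge0 b (s / 2).
move: (a `^ _) (b `^ _) (m `^ _) => x y z y0 x0 z0 h.
suff : 2^-1 * (x ^+ 2 + y ^+ 2) + 8^-1 * (x - y) ^+ 2 <= z ^+ 2 by lra.
rewrite -ler_sqr ?nnegrE ?sqr_ge0//; last first.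
  by rewrite addr_ge0// mulr_ge0// ?addr_ge0 ?sqr_ge0.
apply: le_trans h.
have xy : 0 <= x * y by rewrite mulr_ge0.
have -> : 2^-1 * ((x ^+ 2) ^+ 2 + (y ^+ 2) ^+ 2) =
 (2^-1 * (x ^+ 2 + y ^+ 2)) ^+ 2 + 4^-1 * ((x - y) ^+ 2 * (x + y) ^+ 2) by field.
rewrite sqrrD -addrA lerD2l.
rewrite -subr_ge0.
have -> : 4^-1 * ((x - y) ^+ 2 * (x + y) ^+ 2) -
 (2^-1 * (x ^+ 2 + y ^+ 2) * (8^-1 * (x - y) ^+ 2) *+ 2 +
  (8^-1 * (x - y) ^+ 2) ^+ 2) = (x - y) ^+ 2 *
   (64^-1 * (7 * x ^+ 2 + 7 * y ^+ 2 + 34 * (x * y))) by field.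
rewrite mulr_ge0 ?sqr_ge0// mulr_ge0// !addr_ge0 ?mulr_ge0 ?sqr_ge0//.
Qed.

(** Interpolation of L_1 between L_2 and L_p, pointwise for a / b and the
    density b^2: distinguish a / b >= A from a / b <= A. *)
Lemma mul_le_sq_pow p a b A : 0 < p < 1 -> 0 <= a -> 0 <= b -> 0 < A ->
  a * b <= a ^+ 2 / A + A `^ (1 - p) * (a `^ p * b `^ (2 - p)).
Proof.
move=> p01 a0 b0 A0; have [Ab|Ab] := leP (A * b) a.
  rewrite ler_wpDr ?mulr_ge0 ?powR_ge0// expr2 -mulrA ler_wpM2l//.
  by rewrite ler_pdivlMr// mulrC.
rewrite ler_wpDl//; first by rewrite divr_ge0 ?sqr_ge0 ?ltW.
have [->|bN0] := eqVneq b 0.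
  by rewrite mulr0 !mulr_ge0 ?powR_ge0.
have -> : b `^ (2 - p) = b * b `^ (1 - p).
  rewrite -{2}(powRr1 b0) -powRD ?bN0 ?implybT//; congr powR; lra.
have [->|aN0] := eqVneq a 0; first by rewrite mul0r !mulr_ge0 ?powR_ge0.
have -> : A `^ (1 - p) * (a `^ p * (b * b `^ (1 - p))) =
   a `^ p * (b * (A * b) `^ (1 - p)) by rewrite powRM// 1?ltW//; ring.
have {1}-> : a = a `^ p * a `^ (1 - p).
  by rewrite -powRD ?aN0 ?implybT// subrKC powRr1.
rewrite -mulrA ler_wpM2l ?powR_ge0// mulrC ler_wpM2l// ge0_ler_powR ?nnegrE//.
- lra.
- by rewrite mulr_ge0// ltW.
- exact: ltW.
Qed.

(** On the probability space of density b^2, the L_p norm of a / b is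
    controlled by its L_1 norm; optimizing A recovers Jensen's inequality up to
    a factor. *)
Lemma pow_mul_le p a b A : 0 < p < 1 -> 0 <= a -> 0 <= b -> 0 < A ->
  a `^ p * b `^ (2 - p) <= A `^ p * b ^+ 2 + A `^ (p - 1) * (a * b).
Proof.
move=> p01 a0 b0 A0; have [->|bN0] := eqVneq b 0.
  by rewrite powR0 ?mulr0 ?expr0n ?mulr0 ?addr0//; lra.
have [aA|Aa] := leP a (A * b).
  rewrite ler_wpDr ?mulr_ge0 ?powR_ge0//.
  have -> : b ^+ 2 = b `^ p * b `^ (2 - p).
    by rewrite -powRD ?bN0 ?implybT// subrKC powR_mulrn.
  rewrite mulrA ler_wpM2r ?powR_ge0// -powRM ?(ltW A0)//.
  rewrite ge0_ler_powR ?nnegrE//; first lra.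
  by rewrite mulr_ge0// ltW.
rewrite ler_wpDl ?mulr_ge0 ?powR_ge0 ?sqr_ge0//.
have ap : 0 < a by rewrite (le_lt_trans _ Aa)// mulr_ge0// ltW.
have -> : b `^ (2 - p) = b * b `^ (1 - p).
  rewrite -{2}(powRr1 b0) -powRD ?bN0 ?implybT//; congr powR; lra.
have -> : a `^ p = a * a `^ (p - 1) by rewrite mulr_powRB1//; lra.
rewrite -opprB !powRN.
have -> : a / a `^ (1 - p) * (b * b `^ (1 - p)) =
  a * b * (b `^ (1 - p) / a `^ (1 - p)) by ring.
rewrite mulrC ler_wpM2r ?mulr_ge0//.
rewrite ler_pdivrMr ?powR_gt0// mulrC ler_pdivlMr ?powR_gt0//.
rewrite -powRM//; last exact: ltW.
rewrite ge0_ler_powR ?nnegrE//; first lra.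
  by rewrite mulr_ge0// ltW.
by rewrite mulrC ltW.
Qed.

Lemma powR_cvg (u : nat -> R) (l r : R) : 0 < r -> (forall n, 0 <= u n) ->
  u @ \oo --> l -> (fun n => u n `^ r) @ \oo --> l `^ r.
Proof.
move=> r0 u0 ul; have l0 : 0 <= l.
  by rewrite -(cvg_lim _ ul)//; apply: limr_ge; [apply/cvg_ex; exists l|exact: nearW].
have [lE|lN0] := eqVneq l 0.
  rewrite lE powR0 ?gt_eqF//; apply/cvgrPdist_lt => e e0.
  move/cvgrPdist_lt : ul => /(_ (e `^ r^-1) (powR_gt0 _ e0)).
  apply: filterS => n; rewrite lE !sub0r !normrN ger0_norm// ger0_norm ?powR_ge0//.
  move=> h; have : (u n) `^ r < (e `^ r^-1) `^ r.
    by rewrite gt0_ltr_powR ?nnegrE ?powR_ge0.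
  by rewrite -powRrM mulVf ?gt_eqF// powRr1// ltW.
have lp : 0 < l by rewrite lt_neqAle eq_sym lN0.
have cont : {for l, continuous (fun x => x `^ r)}.
  apply: differentiable_continuous; apply/derivable1_diffP.
  by apply: derivable_powR; rewrite in_itv/= lp.
exact: (cvg_comp _ _ ul cont).
Qed.

End powers.

(** A form of the Cauchy-Schwarz inequality free of square roots. *)
Lemma sum_mul_le (R : realType) (n : nat) (a b : 'I_n -> R) (B : R) : 0 < B ->
  \sum_i a i ^+ 2 <= 1 -> \sum_i b i ^+ 2 <= B ^+ 2 -> \sum_i a i * b i <= B.
Proof.
move=> B0 a1 bB.
apply: (@le_trans _ _ (\sum_i (B / 2 * a i ^+ 2 + (2 * B)^-1 * b i ^+ 2))).
  apply: ler_sum => i _; rewrite -subr_ge0.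
  have -> : B / 2 * a i ^+ 2 + (2 * B)^-1 * b i ^+ 2 - a i * b i =
    (B * a i - b i) ^+ 2 / (2 * B) by field; rewrite gt_eqF.
  by rewrite divr_ge0 ?sqr_ge0// mulr_ge0// ltW.
rewrite big_split -!mulr_sumr/=.
apply: (@le_trans _ _ (B / 2 * 1 + (2 * B)^-1 * B ^+ 2)).
  by rewrite lerD// ler_wpM2l ?divr_ge0 ?invr_ge0 ?mulr_ge0 ?(ltW B0).
by rewrite le_eqVlt; apply/orP; left; apply/eqP; field; rewrite gt_eqF.
Qed.

(** * Integrals of nonnegative functions and almost everywhere limits *)

Lemma cvg_geometric_steps (R : realType) (u : nat -> R) (b : R) :
  (forall n, `|u n.+1 - u n| <= b * 2^-1 ^+ n) -> cvgn u.
Proof.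
move=> ub.
rewrite (_ : u = (fun n => u 0%N + series (telescope u) n)); last first.
  by apply/funext => n; exact: eq_sum_telescope.
apply: is_cvgD; first exact: is_cvg_cst.
apply: normed_cvg; apply: (@series_le_cvg _ _ (geometric b 2^-1)).
- by move=> n; exact: normr_ge0.
- by move=> n; rewrite /= (le_trans _ (ub n)).
- by move=> n; exact: ub.
- by apply: is_cvg_geometric_series; rewrite ger0_norm ?invr_ge0//; lra.
Qed.

Section measure_limits.
Context d (T : measurableType d) (R : realType).
Variable mu : {measure set T -> \bar R}.
Local Open Scope ereal_scope.

Lemma int_scale (f : T -> R) (a : R) : measurable_fun setT f ->
  (forall x, 0 <= f x)%R -> (0 <= a)%R ->
  \int[mu]_x (a * f x)%:E = a%:E * \int[mu]_x (f x)%:E.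
Proof.
move=> mf f0 a0; under eq_integral do rewrite EFinM.
by rewrite ge0_integralZl//; [exact/measurable_EFinP|move=> x _; rewrite lee_fin].
Qed.

Lemma int_add (f g : T -> R) : measurable_fun setT f ->
  measurable_fun setT g -> (forall x, 0 <= f x)%R -> (forall x, 0 <= g x)%R ->
  \int[mu]_x (f x + g x)%:E = \int[mu]_x (f x)%:E + \int[mu]_x (g x)%:E.
Proof.
move=> mf mg f0 g0; under eq_integral do rewrite EFinD.
by rewrite ge0_integralD//; do ?[exact/measurable_EFinP|move=> x _; rewrite lee_fin].
Qed.

Lemma int_ae_le (f g : T -> R) : measurable_fun setT f ->
  measurable_fun setT g -> (forall x, 0 <= f x)%R -> (forall x, 0 <= g x)%R ->
  {ae mu, forall x, f x <= g x}%R ->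
  \int[mu]_x (f x)%:E <= \int[mu]_x (g x)%:E.
Proof.
move=> mf mg f0 g0 fg; apply: ae_ge0_le_integral => //;
  do ?[exact/measurable_EFinP|by move=> x _; rewrite lee_fin].
by apply: filterS fg => x fgx _; rewrite lee_fin.
Qed.

Lemma measurable_invr (a : T -> R) : measurable_fun setT a ->
  (forall x, 0 <= a x)%R -> measurable_fun setT (fun x => (a x)^-1)%R.
Proof.
move=> ma a0; under eq_fun do rewrite -powR_inv1//.
exact: (measurableT_comp (measurable_powR _) ma).
Qed.

Lemma measurable_inve (a : T -> R) : measurable_fun setT a ->
  (forall x, 0 <= a x)%R -> measurable_fun setT (fun x => (a x)%:E^-1).
Proof.
move=> ma a0.
rewrite (_ : (fun _ => _) =
    fun x => if a x == 0%R then +oo else (a x)^-1%:E); last first.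
  by apply/funext => x; rewrite inver.
apply: measurable_fun_ifT => //; first exact: measurable_fun_eqr.
by apply/measurable_EFinP; exact: measurable_invr.
Qed.

Lemma fatou_ae (g : nat -> T -> \bar R) (g0 : T -> \bar R) (c : nat -> R)
    (c0 : R) :
  (forall n, measurable_fun setT (g n)) -> measurable_fun setT g0 ->
  (forall n x, 0 <= g n x) -> (forall x, 0 <= g0 x) ->
  {ae mu, forall x, g n x @[n --> \oo] --> g0 x} ->
  (forall n, \int[mu]_x g n x <= (c n)%:E) -> c @ \oo --> c0 ->
  \int[mu]_x g0 x <= c0%:E.
Proof.
move=> mg mg0 gge0 g0ge0 gcvg gc cc0.
have m_inf : measurable_fun setT (fun x => limn_einf (g ^~ x)).
  rewrite (_ : (fun _ => _) = fun x => - limn_esup (-%E \o g ^~ x)).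
    apply: measurableT_comp => //.
    apply: (measurable_fun_limn_esup (f := fun n x => - g n x)) => n.
    exact: measurableT_comp.
  by apply/funext => x; rewrite limn_esupN oppeK.
have inf_ge0 x : 0 <= limn_einf (g ^~ x).
  rewrite limn_einf_lim; apply: lime_ge; first exact: is_cvg_einfs.
  by apply: nearW => n; apply: le_ereal_inf_tmp => _ [m _ <-]; exact: gge0.
have -> : \int[mu]_x g0 x = \int[mu]_x limn_einf (g ^~ x).
  apply: ge0_ae_eq_integral => //.
  by apply: filterS gcvg => x gx _; rewrite (cvg_limn_einf_sup gx).1.
apply: le_trans (fatou mu measurableT mg (fun n x _ => gge0 n x)) _.
have cE : (EFin \o c) @ \oo --> c0%:E by apply: cvg_EFin => //; exact: nearW.
rewrite limn_einf_lim -(cvg_lim _ cE)//.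
apply: lee_lim; [exact: is_cvg_einfs|by apply/cvg_ex; exists c0%:E|].
apply: nearW => n /=; apply: le_trans (gc n).
by apply: ereal_inf_lbound; exists n => /=.
Qed.

Lemma ae_lty (f : T -> \bar R) (M : R) : measurable_fun setT f ->
  (forall x, 0 <= f x) -> \int[mu]_x f x <= M%:E ->
  {ae mu, forall x, f x < +oo}.
Proof.
move=> mf f0 fM; have fi : mu.-integrable setT f.
  apply/integrableP; split => //.
  under eq_integral do rewrite gee0_abs//.
  by rewrite (le_lt_trans fM)// ltry.
apply: filterS (integrable_ae measurableT fi) => x /(_ Logic.I).
by rewrite ge0_fin_numE.
Qed.

(** The weights 4^n keep the series of the integrals convergent, and almost
    everywhere finiteness of the weighted series forces steps of order 2^-n. *)
Lemma ae_cvg_of_l2_steps (u : nat -> T -> R) (K : R) :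
  (forall n, measurable_fun setT (u n)) ->
  (forall n, \int[mu]_x ((u n.+1 x - u n x) ^+ 2)%:E <= (K * 8^-1 ^+ n)%:E) ->
  {ae mu, forall x, cvgn (u ^~ x)}.
Proof.
move=> mu_ step.
pose g n x := (4 ^+ n * (u n.+1 x - u n x) ^+ 2)%:E : \bar R.
have g0 n x : 0 <= g n x by rewrite lee_fin mulr_ge0 ?sqr_ge0 ?exprn_ge0.
have md n : measurable_fun setT (fun x => ((u n.+1 x - u n x) ^+ 2)%:E).
  apply/measurable_EFinP; apply: measurable_funX.
  exact: measurable_funB.
have mg n : measurable_fun setT (g n).
  by rewrite /g; under eq_fun do rewrite EFinM; exact: measurable_funeM.
have K0 : (0 <= K)%R.
  by rewrite -lee_fin; have := step 0%N; rewrite mulr1; apply: le_trans;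
    apply: integral_ge0 => x _; rewrite lee_fin sqr_ge0.
have gI n : \int[mu]_x g n x <= (K * 2^-1 ^+ n)%:E.
  rewrite /g int_scale ?exprn_ge0//; last 2 first.
  - by apply: measurable_funX; exact: measurable_funB.
  - by move=> x; exact: sqr_ge0.
  apply: (@le_trans _ _ ((4 ^+ n)%:E * (K * 8^-1 ^+ n)%:E)).
    by rewrite lee_wpmul2l// lee_fin exprn_ge0.
  rewrite -EFinM lee_fin (_ : 2^-1 = 4 * 8^-1 :> R)%R; last by field.
  by rewrite exprMn mulrCA.
have sI : \int[mu]_x (\sum_(0 <= n <oo) g n x) <= (2 * K)%:E.
  rewrite integral_nneseries//.
  apply: lime_le; first by apply: is_cvg_nneseries => n _ _; exact: integral_ge0.
  apply: nearW => N; rewrite (le_trans (lee_sum _ (fun n _ => gI n)))//.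
  rewrite sumEFin lee_fin -mulr_sumr mulrC ler_wpM2r//.
  have -> : (\sum_(0 <= i < N) 2^-1 ^+ i = 2 - 2 * 2^-1 ^+ N :> R)%R.
    elim: N => [|N IH]; first by rewrite big_geq// expr0; ring.
    by rewrite big_nat_recr//= IH exprS; field.
  by rewrite lerBlDr lerDl mulr_ge0// exprn_ge0// invr_ge0.
have ms : measurable_fun setT (fun x => \sum_(0 <= n <oo) g n x).
  by apply: ge0_emeasurable_sum => // n x _ _; exact: g0.
have s0 x : 0 <= \sum_(0 <= n <oo) g n x by exact: nneseries_ge0.
apply: filterS (ae_lty ms s0 sI) => x sx.
set B := fine (\sum_(0 <= n <oo) g n x).
have BE : B%:E = \sum_(0 <= n <oo) g n x by rewrite fineK// ge0_fin_numE.
have B0 : (0 <= B)%R by exact: fine_ge0.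
apply: (@cvg_geometric_steps _ _ (Num.sqrt B)) => n.
have : g n x <= B%:E.
  rewrite BE (le_trans _ (nneseries_lim_ge n.+1 (fun i _ _ => g0 i x)))//.
  by rewrite big_nat_recr//= leeDr// sume_ge0.
rewrite lee_fin => gB.
rewrite -(ger0_norm (_ : 0 <= Num.sqrt B * 2^-1 ^+ n)%R); last first.
  by rewrite mulr_ge0 ?sqrtr_ge0// exprn_ge0// invr_ge0.
rewrite -ler_sqr ?nnegrE// !real_normK ?num_real// exprMn sqr_sqrtr//.
rewrite -exprM mulnC exprM (_ : 2^-1 ^+ 2 = 4^-1 :> R)%R; last by field.
by rewrite exprVn ler_pdivlMr ?exprn_gt0// mulrC.
Qed.

End measure_limits.

(** * Maurey's change of density *)

Section maurey.
Context d (T : measurableType d) (R : realType).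
Variable mu : {measure set T -> \bar R}.
Local Open Scope ereal_scope.

(** Maurey's theorem for a convex set F of nonnegative functions bounded in
    L_s with s <= 1/2.  The density is h^(1-s), where h is the almost everywhere
    limit of a maximizing sequence of the integral of f^s on F.  Moving from h in
    the direction of f cannot increase the maximum m, to first order; the
    derivative of (h + r f)^s at r = 0 is s f / h^(1-s), and the convexity of F
    allows an increase of at most s r m.
    Although h may fail to attain the maximum or to lie in F, the increments
    (f_n + r f)^s - f_n^s are nonnegative, so that Fatou's lemma passes to the
    limit in them.
    The quotient f / h^(1-s) is infinite where h vanishes and f does not. *)
Lemma maurey_density (s M : R) (F : set (T -> R)) :
  (0 < s <= 2^-1)%R -> F !=set0 ->
  (forall f, F f -> measurable_fun setT f /\ forall x, (0 <= f x)%R) ->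
  (forall f g r, F f -> F g -> (0 <= r)%R ->
     F (fun x => (1 + r)^-1 * (f x + r * g x))%R) ->
  (forall f, F f -> \int[mu]_x (f x `^ s)%:E <= M%:E) ->
  exists h : T -> R, [/\ measurable_fun setT h, forall x, (0 <= h x)%R,
    \int[mu]_x (h x `^ s)%:E <= M%:E &
    forall f, F f ->
      \int[mu]_x ((f x)%:E * ((h x `^ (1 - s))%:E)^-1) <= M%:E].
Proof.
move=> sP [f00 Ff00] Fp Fconv FM.
have s0 : (0 < s)%R by case/andP: sP.
have s1 : (0 < s < 1)%R by case/andP: sP => ? ?; apply/andP; split; lra.
have mpow (f : T -> R) r : measurable_fun setT f ->
    measurable_fun setT (fun x => f x `^ r)%R.
  by move=> mf; exact: (measurableT_comp (measurable_powR r) mf).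
pose I f := \int[mu]_x (f x `^ s)%:E.
have I0 f : 0 <= I f by apply: integral_ge0 => x _; rewrite lee_fin powR_ge0.
have Ifin f : F f -> (fine (I f))%:E = I f.
  by move=> /FM fM; rewrite fineK// ge0_fin_numE// (le_lt_trans fM)// ltry.
pose S := [set fine (I f) | f in F].
have supS : has_sup S.
  split; first by exists (fine (I f00)), f00.
  by exists M => _ [f Ff <-]; rewrite -lee_fin Ifin//; exact: FM.
set m := sup S.
have mM : (m <= M)%R.
  apply: ge_sup; first exact: supS.1.
  by move=> _ [f Ff <-]; rewrite -lee_fin Ifin//; exact: FM.
have Im f : F f -> I f <= m%:E.
  move=> Ff; rewrite -Ifin// lee_fin; apply: ub_le_sup; first exact: supS.2.
  by exists f.
have /choice[f fP] : forall n : nat, exists f, F f /\ (m - 8^-1 ^+ n)%:E <= I f.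
  move=> n; have e0 : (0 < 8^-1 ^+ n :> R)%R by rewrite exprn_gt0// invr_gt0.
  have [_ [f Ff <-] h] := sup_adherent e0 supS.
  by exists f; split => //; rewrite -Ifin// lee_fin ltW.
have Ff n : F (f n) by have [] := fP n.
have fI n : (m - 8^-1 ^+ n)%:E <= I (f n) by have [] := fP n.
have mf n : measurable_fun setT (f n) by have [] := Fp _ (Ff n).
have f0 n x : (0 <= f n x)%R by have [_] := Fp _ (Ff n); exact.
pose u n x := (f n x `^ (s / 2))%R.
have mu_ n : measurable_fun setT (u n) by exact: mpow.
have step n : \int[mu]_x ((u n.+1 x - u n x) ^+ 2)%:E <= (8 * 8^-1 ^+ n)%:E.
  (* The midpoint of two consecutive functions is in F, so its integral is at
     most m while those of f n and f n.+1 are nearly m. *)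
  pose g x := ((1 + 1)^-1 * (f n.+1 x + 1 * f n x))%R.
  have Fg : F g by apply: Fconv.
  have [mg g0] := Fp _ Fg.
  have : \int[mu]_x ((u n.+1 x - u n x) ^+ 2 +
      4 * (f n.+1 x `^ s + f n x `^ s))%:E <= (8 * m)%:E.
    apply: (@le_trans _ _ (\int[mu]_x (8 * g x `^ s)%:E)).
      apply: int_ae_le => //.
      - apply: measurable_funD; first by apply: measurable_funX; exact: measurable_funB.
        by apply: measurable_funM => //; apply: measurable_funD; exact: mpow.
      - by apply: measurable_funM => //; exact: mpow.
      - by move=> x; rewrite addr_ge0 ?sqr_ge0// mulr_ge0// addr_ge0 ?powR_ge0.
      - by move=> x; rewrite mulr_ge0// powR_ge0.
      apply/aeW => x; have := powR_midpoint sP (f0 n.+1 x) (f0 n x).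
      rewrite /g /u mul1r => ?; lra.
    rewrite int_scale//; [|exact: mpow|by move=> x; rewrite powR_ge0].
    by rewrite EFinM lee_wpmul2l ?lee_fin//; exact: Im.
  rewrite int_add; last 4 first.
  - by apply: measurable_funX; exact: measurable_funB.
  - by apply: measurable_funM => //; apply: measurable_funD; exact: mpow.
  - by move=> x; rewrite sqr_ge0.
  - by move=> x; rewrite mulr_ge0// addr_ge0 ?powR_ge0.
  rewrite int_scale//; last 2 first.
  - by apply: measurable_funD; exact: mpow.
  - by move=> x; rewrite addr_ge0 ?powR_ge0.
  rewrite int_add//; last 4 first.
  - exact: mpow.
  - exact: mpow.
  - by move=> x; rewrite powR_ge0.
  - by move=> x; rewrite powR_ge0.
  rewrite -/(I (f n.+1)) -/(I (f n)).
  have := fI n.+1; have := fI n.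
  rewrite -(Ifin _ (Ff n)) -(Ifin _ (Ff n.+1)) !lee_fin.
  rewrite -EFinD -EFinM -leeBrDr// => h1 h2 h3.
  rewrite (le_trans h3)// -EFinB lee_fin.
  move: h1 h2; rewrite exprS.
  have : (0 <= 8^-1 ^+ n :> R)%R by rewrite exprn_ge0// invr_ge0.
  by move: (8^-1 ^+ n : R)%R => q; lra.
have ucvg := ae_cvg_of_l2_steps mu_ step.
pose h0 x := fine (limn_esup (fun n => (u n x)%:E)).
have mh0 : measurable_fun setT h0.
  apply: measurableT_comp => //.
  apply: (measurable_fun_limn_esup (f := fun n x => (u n x)%:E)) => n.
  exact/measurable_EFinP.
pose h x := (h0 x `^ (2 / s))%R.
have mh : measurable_fun setT h by exact: mpow.
have h_ge0 x : (0 <= h x)%R by exact: powR_ge0.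
have fcvg : {ae mu, forall x, f n x @[n --> \oo] --> h x}.
  apply: filterS ucvg => x /cvg_ex[l ul].
  have h0E : h0 x = l.
    have /cvg_limn_einf_sup[_] : (u n x)%:E @[n --> \oo] --> l%:E.
      by apply: cvg_EFin => //; exact: nearW.
    by rewrite /h0 => ->.
  have : (fun n => u n x `^ (2 / s))%R @ \oo --> (l `^ (2 / s))%R.
    apply: powR_cvg => //; first by rewrite divr_gt0.
    by move=> n; exact: powR_ge0.
  rewrite /h h0E; apply: cvg_trans; apply: near_eq_cvg; apply: nearW => n.
  rewrite /u -powRrM (_ : s / 2 * (2 / s) = 1)%R ?powRr1//.
  by field; rewrite gt_eqF.
have eps_cvg : (fun n => 8^-1 ^+ n : R)%R @ \oo --> (0 : R)%R.
  by apply: cvg_expr; rewrite ger0_norm ?invr_ge0//; lra.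
have powE r (g : nat -> R) (l : R) : (0 < r)%R -> (forall n, 0 <= g n)%R ->
    g @ \oo --> l -> (g n `^ r)%:E @[n --> \oo] --> (l `^ r)%:E.
  move=> r0 g0 gl; apply: cvg_EFin; first exact: nearW.
  exact: (powR_cvg r0 g0 gl).
exists h; split => //.
  apply: (@fatou_ae _ _ _ mu (fun n x => (f n x `^ s)%:E) _ (cst M)).
  - by move=> n; apply/measurable_EFinP; exact: mpow.
  - by apply/measurable_EFinP; exact: mpow.
  - by move=> n x; rewrite lee_fin powR_ge0.
  - by move=> x; rewrite lee_fin powR_ge0.
  - by apply: filterS fcvg => x fx; exact: powE.
  - by move=> n; exact: FM.
  - exact: cvg_cst.
move=> g Fg; have [mg g0] := Fp _ Fg.
(* First-order optimality in the direction g, before the limit r -> 0. *)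
have incr r : (0 < r)%R ->
    \int[mu]_x (g x * (h x + r * g x) `^ (s - 1))%:E <= m%:E.
  move=> r0; have r0' := ltW r0.
  have m_hr : measurable_fun setT (fun x => h x + r * g x)%R.
    by apply: measurable_funD => //; exact: measurable_funM.
  have hr0 x : (0 <= h x + r * g x)%R by rewrite addr_ge0// mulr_ge0.
  have m_fr n : measurable_fun setT (fun x => f n x + r * g x)%R.
    by apply: measurable_funD => //; exact: measurable_funM.
  have fr0 n x : (0 <= f n x + r * g x)%R by rewrite addr_ge0// mulr_ge0.
  have diff_ge0 (a b : R) : (0 <= a)%R -> (0 <= b)%R ->
      (0 <= (a + b) `^ s - a `^ s)%R.
    move=> a0 b0; rewrite subr_ge0 ge0_ler_powR ?nnegrE ?addr_ge0//.
      exact: ltW.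
    by rewrite lerDl.
  have incr_n n : \int[mu]_x ((f n x + r * g x) `^ s - f n x `^ s)%:E <=
      (s * r * m + 8^-1 ^+ n)%:E.
    (* The function f n + r g is 1 + r times an element of F, and
       (1 + r)^s <= 1 + s r. *)
    pose k x := ((1 + r)^-1 * (f n x + r * g x))%R.
    have Fk : F k by exact: Fconv.
    have kE x : ((f n x + r * g x) `^ s = (1 + r) `^ s * k x `^ s)%R.
      rewrite -powRM//; last 2 first.
      - by rewrite addr_ge0.
      - by rewrite mulr_ge0// invr_ge0 addr_ge0.
      by rewrite mulVKf// gt_eqF// addr_gt0.
    have : \int[mu]_x ((f n x + r * g x) `^ s - f n x `^ s)%:E + I (f n) <=
        ((1 + s * r) * m)%:E.
      rewrite -int_add//; last 4 first.
      - by apply: measurable_funB; exact: mpow.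
      - exact: mpow.
      - by move=> x; apply: diff_ge0 => //; exact: mulr_ge0.
      - by move=> x; exact: powR_ge0.
      under eq_integral do rewrite subrK kE.
      rewrite int_scale ?powR_ge0//; [|exact: mpow (Fp _ Fk).1|by move=> x; exact: powR_ge0].
      rewrite EFinM; apply: lee_pmul.
      - by rewrite lee_fin powR_ge0.
      - exact: I0.
      - rewrite lee_fin; have := powR_le_tangent s1 (_ : 0 <= 1 + r)%R.
        by rewrite addrAC subrr add0r; apply; rewrite addr_ge0.
      - exact: Im.
    have := fI n; rewrite -(Ifin _ (Ff n)) lee_fin -leeBrDr// => fIn h1.
    rewrite (le_trans h1)// -EFinB lee_fin; move: fIn.
    by move: (8^-1 ^+ n : R)%R => q ?; lra.
  have : \int[mu]_x ((h x + r * g x) `^ s - h x `^ s)%:E <= (s * r * m)%:E.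
    apply: (@fatou_ae _ _ _ mu
      (fun n x => ((f n x + r * g x) `^ s - f n x `^ s)%:E) _
      (fun n => s * r * m + 8^-1 ^+ n)%R).
    - by move=> n; apply/measurable_EFinP; apply: measurable_funB; exact: mpow.
    - by apply/measurable_EFinP; apply: measurable_funB; exact: mpow.
    - by move=> n x; rewrite lee_fin diff_ge0// mulr_ge0.
    - by move=> x; rewrite lee_fin diff_ge0// mulr_ge0.
    - apply: filterS fcvg => x fx; apply: cvg_EFin; first exact: nearW.
      apply: cvgB; last exact: (powR_cvg s0 (f0 ^~ x) fx).
      apply: (powR_cvg s0 (fr0 ^~ x)).
      by apply: cvgD => //; exact: cvg_cst.
    - exact: incr_n.
    - by rewrite -[X in _ --> X]addr0; apply: cvgD => //; exact: cvg_cst.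
  have sr0 : (0 < s * r)%R by rewrite mulr_gt0.
  have gk0 x : (0 <= g x * (h x + r * g x) `^ (s - 1))%R.
    by rewrite mulr_ge0 ?powR_ge0.
  move=> h1; rewrite -(lee_pmul2l (x := (s * r)%:E)) ?lte_fin// -EFinM.
  apply: le_trans h1; rewrite -int_scale//; last 2 first.
  - by apply: measurable_funM => //; exact: mpow.
  - exact: ltW.
  apply: int_ae_le => //.
  - by do 2!apply: measurable_funM => //; exact: mpow.
  - by apply: measurable_funB; exact: mpow.
  - by move=> x; exact: mulr_ge0 (ltW sr0) (gk0 x).
  - by move=> x; rewrite diff_ge0// mulr_ge0.
  apply/aeW => x; have [gx0|gx0] := eqVneq (g x) 0%R.
    by rewrite gx0 mul0r !mulr0 addr0 subrr.
  have hp : (0 < h x + r * g x)%R.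
    by rewrite ltr_wpDl// mulr_gt0// lt_neqAle eq_sym gx0 g0.
  have := powR_sub_ge s1 (h_ge0 x) hp; rewrite addrC addKr.
  by rewrite mulrA (mulrA s).
apply: (@fatou_ae _ _ _ mu
  (fun n x => (g x * (h x + n.+1%:R^-1 * g x) `^ (s - 1))%:E) _ (cst M)).
- move=> n; apply/measurable_EFinP; apply: measurable_funM => //; apply: mpow.
  by apply: measurable_funD => //; exact: measurable_funM.
- apply: emeasurable_funM; first exact/measurable_EFinP.
  by apply: measurable_inve; [exact: mpow|move=> x; exact: powR_ge0].
- by move=> n x; rewrite lee_fin mulr_ge0 ?powR_ge0.
- by move=> x; rewrite mule_ge0 ?lee_fin// inve_ge0 lee_fin powR_ge0.
- apply/aeW => x; have [gx0|gx0] := eqVneq (g x) 0%R.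
    by rewrite gx0 mul0e; under eq_fun do rewrite mul0r; exact: cvg_cst.
  have gxp : (0 < g x)%R by rewrite lt_neqAle eq_sym gx0 g0.
  have s1p : (0 < 1 - s)%R by lra.
  have harm : (n.+1%:R^-1 * g x)%R @[n --> \oo] --> (0 : R)%R.
    rewrite -(mul0r (g x)); apply: cvgMl; exact: cvg_harmonic.
  have base_cvg : (h x + n.+1%:R^-1 * g x)%R @[n --> \oo] --> h x.
    by rewrite -[X in _ --> X]addr0; apply: cvgD => //; exact: cvg_cst.
  have base_ge0 n : (0 <= h x + n.+1%:R^-1 * g x)%R by rewrite addr_ge0 ?mulr_ge0.
  have pow_cvg := powR_cvg s1p base_ge0 base_cvg.
  have powV n : ((h x + n.+1%:R^-1 * g x) `^ (s - 1) =
      ((h x + n.+1%:R^-1 * g x) `^ (1 - s))^-1)%R by rewrite -powRN opprB.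
  have [hx0|hx0] := eqVneq (h x) 0%R.
    rewrite hx0 powR0 ?gt_eqF// inve0 gt0_muley ?lte_fin//.
    apply/cvgeryP; apply/cvgryPge => A.
    set c := (`|A| / g x `^ s)%R.
    have gs : (0 < g x `^ s)%R by exact: powR_gt0.
    have c0 : (0 <= c)%R by rewrite divr_ge0 ?powR_ge0.
    apply: filterS (nbhs_infty_ger (c `^ (1 - s)^-1)) => n cn.
    have nc : (c <= n.+1%:R `^ (1 - s))%R.
      have := @ge0_ler_powR _ _ (ltW s1p) _ _ _ _ cn.
      rewrite !nnegrE powR_ge0 ler0n -powRrM mulVf ?gt_eqF// powRr1// => cn'.
      rewrite (le_trans (cn' _ _))// ge0_ler_powR ?nnegrE//; first exact: ltW.
      by rewrite ler_nat.
    rewrite add0r -opprB powRN powRM ?invr_ge0//.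
    rewrite -{1}(powR_inv1 (ler0n _ _)) -powRrM mulN1r powRN invfM invrK.
    rewrite (le_trans (ler_norm A))// mulrCA -powRN opprB mulr_powRB1//.
    by rewrite -ler_pdivrMr.
  have hxp : (0 < h x `^ (1 - s))%R.
    by rewrite powR_gt0// lt_neqAle eq_sym hx0 h_ge0.
  rewrite inver gt_eqF// -EFinM; apply: cvg_EFin; first exact: nearW.
  apply: cvgM; first exact: cvg_cst.
  by under eq_fun do rewrite powV; apply: cvgV => //; rewrite gt_eqF.
- move=> n; apply: (@le_trans _ _ m%:E); last by rewrite lee_fin.
  by apply: incr; rewrite invr_gt0.
- exact: cvg_cst.
Qed.

End maurey.

(** * Two-convex operators into L_p *)

Section two_convex.
Context d (Om : measurableType d) (R : realType) (k : scalar_field).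
Variables (mu : {measure set Om -> \bar R}) (p : R) (p0 : 0 < p).
Local Notation Lp := (Lp_space k mu p0).
Implicit Types q r : Lp.

Definition absval q : Om -> R := fun w => modulus (Lp_repr q w).

Lemma absval_ge0 q w : 0 <= absval q w.
Proof. exact: modulus_ge0. Qed.

Lemma scalar_measurable_repr q : scalar_measurable (Lp_repr q).
Proof. by have /Lp_predP[] := valP (Lp_repr q). Qed.

Lemma measurable_absval q : measurable_fun setT (absval q).
Proof. exact: measurable_modulus (scalar_measurable_repr q). Qed.

(** The quasi-norm of L_p is defined by an extended real root; this is its
    real form. *)
Lemma int_absval q : (\int[mu]_w (absval q w `^ p)%:E = (qnorm q `^ p)%:E)%E.
Proof.
have /Lp_predP[_] := valP (Lp_repr q).
have -> : qnorm q = fine (Lp_norm mu p (Lp_repr q)) by [].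
rewrite Lp_norm_int -/(absval q).
have I0 : (0 <= \int[mu]_w (absval q w `^ p)%:E)%E.
  by apply: integral_ge0 => x _; rewrite lee_fin powR_ge0.
have pN0 : p^-1 != 0 by rewrite invr_neq0 ?gt_eqF.
move=> h; have Ifin : (\int[mu]_w (absval q w `^ p)%:E < +oo)%E.
  exact: (lty_poweRy pN0 h).
rewrite -[in RHS](@fineK _ (\int[mu]_w _)%E) ?ge0_fin_numE//.
by rewrite poweR_EFin/= -powRrM mulVf ?gt_eqF// powRr1 ?fine_ge0// fineK// ge0_fin_numE.
Qed.

Lemma repr_lin (a : scalars R k) q r :
  {ae mu, forall w, Lp_repr (a *: q + r) w = a * Lp_repr q w + Lp_repr r w}.
Proof.
have -> : a *: q + r = Lp_class (a *: Lp_repr q + Lp_repr r).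
  by rewrite Lp_classD Lp_reprK.
exact: Lp_class_repr.
Qed.

Lemma absval0 : {ae mu, forall w, absval 0 w = 0}.
Proof.
have := @Lp_class_repr _ Om R k mu p p0 0.
by apply: filterS => w; rewrite Lp_class0 /absval => ->; rewrite modulus0.
Qed.

Variable X : quasiNormedModType R k.
Implicit Types (T : bounded_op X Lp) (s : seq (R * X)).

(** The square function is kept without its root, and with real weights a.1, so
    that the square functions of families of weight at most 1 form a convex set
    on the nose, although T is linear only almost everywhere. *)
Definition sqfun T s w := \sum_(a <- s) (a.1 * absval (T a.2) w) ^+ 2.

Definition sqweight s := \sum_(a <- s) (a.1 * qnorm a.2) ^+ 2.

(** With sqfun in place of the square function itself, the p-th power of the
    L_p norm carries the exponent p / 2. *)
Definition two_convex T (c : R) := forall s, sqweight s <= 1 ->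
  (\int[mu]_w (sqfun T s w `^ (p / 2))%:E <= (c `^ p)%:E)%E.

Lemma sqfun_ge0 T s w : 0 <= sqfun T s w.
Proof. by apply: sumr_ge0 => a _; rewrite sqr_ge0. Qed.

Lemma measurable_sqfun T s : measurable_fun setT (sqfun T s).
Proof.
apply: measurable_sum => a; apply: measurable_funX.
by apply: measurable_funM => //; exact: measurable_absval.
Qed.

Lemma sqfun_cat T s1 s2 w : sqfun T (s1 ++ s2) w = sqfun T s1 w + sqfun T s2 w.
Proof. by rewrite /sqfun big_cat. Qed.

Lemma sqfun_scale T l s w :
  sqfun T [seq (l * a.1, a.2) | a <- s] w = l ^+ 2 * sqfun T s w.
Proof.
by rewrite /sqfun big_map mulr_sumr; apply: eq_bigr => a _/=; rewrite -exprMn mulrA.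
Qed.

Lemma sqweight_scale l s :
  sqweight [seq (l * a.1, a.2) | a <- s] = l ^+ 2 * sqweight s.
Proof.
by rewrite /sqweight big_map mulr_sumr; apply: eq_bigr => a _/=; rewrite -exprMn mulrA.
Qed.

(** Maurey's theorem with s = p / 2 for the convex set of square functions;
    v is the normalized square root of the density h^(1-s), and 1/t = 1/p - 1/2
    makes v^t a multiple of h^s. *)
Lemma two_convex_factor T (c t : R) : p < 1 -> t^-1 = p^-1 - 2^-1 ->
  0 < c -> two_convex T c ->
  exists v : Om -> R, [/\ measurable_fun setT v, forall w, 0 <= v w,
    (\int[mu]_w (v w `^ t)%:E <= 1)%E &
    forall x, (\int[mu]_w ((absval (T x) w ^+ 2)%:E * (v w ^+ 2)%:E^-1) <=
               ((c * qnorm x) ^+ 2)%:E)%E].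
Proof.
move=> p1 tE c0 Tc.
have pN0 : p != 0 by rewrite gt_eqF.
have p2N0 : 2 - p != 0 by rewrite gt_eqF// subr_gt0; lra.
have {}tE : t = 2 * p / (2 - p).
  by rewrite -[t]invrK tE; field; rewrite pN0 p2N0.
pose F := [set f | exists2 s, sqweight s <= 1 & f = sqfun T s].
have [||||f|h [mh h0 hI hF]] := @maurey_density _ Om R mu (p / 2) (c `^ p) F.
- by rewrite divr_gt0//= ler_piMl// ltW.
- by exists (sqfun T [::]), [::] => //; rewrite /sqweight big_nil.
- by move=> _ [s _ ->]; split; [exact: measurable_sqfun|exact: sqfun_ge0].
- move=> _ _ r [s1 s1w ->] [s2 s2w ->] r0.
  have r1 : 0 < 1 + r by rewrite ltr_pwDl.
  exists ([seq (Num.sqrt (1 + r)^-1 * a.1, a.2) | a <- s1] ++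
          [seq (Num.sqrt (r / (1 + r)) * a.1, a.2) | a <- s2]).
    rewrite /sqweight big_cat/= -!/(sqweight _) !sqweight_scale.
    rewrite !sqr_sqrtr ?divr_ge0 ?invr_ge0 ?(ltW r1)//.
    rewrite [r / _]mulrC -mulrA -mulrDr ler_pdivrMl// mulr1 lerD//.
    by rewrite ler_piMr.
  apply/funext => w; rewrite sqfun_cat !sqfun_scale.
  rewrite !sqr_sqrtr ?divr_ge0 ?invr_ge0 ?(ltW r1)//.
  by rewrite mulrDr; congr (_ + _); rewrite mulrA [r / _]mulrC.
- by move=> [s sw ->]; exact: Tc.
have mpow (f : Om -> R) (e : R) : measurable_fun setT f ->
    measurable_fun setT (fun x => f x `^ e).
  by move=> mf; exact: (measurableT_comp (measurable_powR e) mf).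
exists (fun w => c `^ (p / 2 - 1) * h w `^ ((1 - p / 2) / 2)); split.
- by apply: measurable_funM => //; exact: mpow.
- by move=> w; rewrite mulr_ge0 ?powR_ge0.
- under eq_integral.
    move=> w _; rewrite powRM ?powR_ge0// -!powRrM.
    rewrite (_ : (p / 2 - 1) * t = - p); last by rewrite tE; field; rewrite p2N0.
    rewrite (_ : (1 - p / 2) / 2 * t = p / 2); last by rewrite tE; field; rewrite p2N0.
    over.
  rewrite int_scale ?powR_ge0//; last 2 first.
  - exact: mpow.
  - by move=> x; exact: powR_ge0.
  apply: (@le_trans _ _ ((c `^ (- p))%:E * (c `^ p)%:E)%E).
    by rewrite lee_wpmul2l// lee_fin powR_ge0.
  by rewrite -EFinM powRN mulVf// gt_eqF// powR_gt0.
move=> x.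
pose a w := absval (T x) w ^+ 2.
have a0 w : 0 <= a w by exact: sqr_ge0.
have ma : measurable_fun setT a by apply: measurable_funX; exact: measurable_absval.
have mhV : measurable_fun setT (fun w => (h w `^ (1 - p / 2))%:E^-1)%E.
  by apply: measurable_inve; [exact: mpow|move=> w; exact: powR_ge0].
have hV0 w : (0 <= (h w `^ (1 - p / 2))%:E^-1)%E by rewrite inve_ge0 lee_fin powR_ge0.
have mah : measurable_fun setT (fun w => (a w)%:E * (h w `^ (1 - p / 2))%:E^-1)%E.
  by apply: emeasurable_funM => //; exact/measurable_EFinP.
have main : (\int[mu]_w ((a w)%:E * (h w `^ (1 - p / 2))%:E^-1) <=
    (c `^ p * qnorm x ^+ 2)%:E)%E.
  have [x0|xN0] := eqVneq (qnorm x) 0.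
    rewrite x0 expr0n mulr0 (qnorm_eq0 _ x0) in a a0 ma mah *.
    rewrite (_ : (\int[mu]_w _)%E = 0%E)//.
    transitivity (\int[mu]_w cst 0%E w)%E; last by rewrite integral0.
    apply: ge0_ae_eq_integral => //.
      by move=> w _; rewrite mule_ge0// lee_fin ?sqr_ge0.
    apply: filterS absval0 => w w0 _.
    by rewrite /a linear0 w0 expr0n mul0e.
  have xp : 0 < qnorm x by rewrite lt_neqAle eq_sym xN0 qnorm_ge0.
  have /hF : F (sqfun T [:: ((qnorm x)^-1, x)]).
    by exists [:: ((qnorm x)^-1, x)] => //; rewrite /sqweight big_seq1 mulVf// expr1n.
  under eq_integral.
    move=> w _; rewrite /sqfun big_seq1/= exprMn EFinM -muleA; over.
  rewrite ge0_integralZl ?lee_fin ?sqr_ge0//; last first.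
    by move=> w _; rewrite mule_ge0// lee_fin ?sqr_ge0.
  rewrite -lee_pdivlMl ?exprn_gt0 ?invr_gt0// -exprVn invrK -EFinM.
  by rewrite (mulrC (_ ^+ 2)).
under eq_integral.
  move=> w _.
  rewrite (_ : (_ * _)%E = ((c `^ (2 - p))%:E *
      ((a w)%:E * (h w `^ (1 - p / 2))%:E^-1))%E).
    over.
  rewrite exprMn muleCA; congr (_ * _)%E.
  rewrite -!powR_mulrn ?powR_ge0// -!powRrM divfK//.
  rewrite (_ : (p / 2 - 1) * 2 = - (2 - p)); last by field.
  rewrite powRN.
  have cp : 0 < c `^ (2 - p) by exact: powR_gt0.
  rewrite !inver mulf_eq0 invr_eq0 gt_eqF//=; case: ifPn => _.
    by rewrite gt0_muley.
  by rewrite invfM invrK EFinM.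
rewrite ge0_integralZl ?lee_fin ?powR_ge0//; last first.
  by move=> w _; rewrite mule_ge0// lee_fin ?sqr_ge0.
apply: (@le_trans _ _ ((c `^ (2 - p))%:E * (c `^ p * qnorm x ^+ 2)%:E)%E).
  by rewrite lee_wpmul2l// lee_fin powR_ge0.
rewrite -EFinM lee_fin mulrA exprMn -powRD; last first.
  by apply/implyP => _; rewrite gt_eqF.
by rewrite subrK powR_mulrn// ltW.
Qed.

End two_convex.

(** * Fourth moments of Rademacher sums *)

Section khintchine.
Variable R : realType.

Definition signed_sum n (a : 'I_n -> R) (A : {set 'I_n})
    (e : {ffun 'I_n -> bool}) := \sum_(i in A) (-1) ^+ e i * a i.

Definition flip n (j : 'I_n) (e : {ffun 'I_n -> bool}) :=
  [ffun i => e i (+) (i == j)].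

Lemma flipK n (j : 'I_n) : involutive (@flip n j).
Proof. by move=> e; apply/ffunP => i; rewrite !ffunE -addbA addbb addbF. Qed.

Lemma sum_odd_sign n (j : 'I_n) (f : {ffun 'I_n -> bool} -> R) :
  (forall e, f (flip j e) = f e) -> \sum_e f e * (-1) ^+ e j = 0.
Proof.
move=> fE; set S := LHS; suff : S + S == 0 by rewrite -mulr2n mulrn_eq0 => /eqP.
rewrite {1}/S(reindex_inj (can_inj (@flipK n j))) -big_split big1// => e _ /=.
rewrite fE ffunE eqxx addbT -mulrDr.
by case: (e j); rewrite /= ?expr1 ?expr0 ?subrr ?addNr mulr0.
Qed.

Lemma signed_sum_flip n (a : 'I_n -> R) (A : {set 'I_n}) j e : j \notin A ->
  signed_sum a A (flip j e) = signed_sum a A e.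
Proof.
move=> jA; apply: eq_bigr => i iA; rewrite ffunE.
by case: eqP => [ij|_]; [move: jA; rewrite -ij iA|rewrite addbF].
Qed.

Lemma signed_sumU1 n (a : 'I_n -> R) (A : {set 'I_n}) j e : j \notin A ->
  signed_sum a (j |: A) e = signed_sum a A e + (-1) ^+ e j * a j.
Proof. by move=> jA; rewrite /signed_sum big_setU1// addrC. Qed.

(** Induction on the support: expanding (x + e_j a_j)^k, the odd powers of e_j
    cancel because flipping the sign e_j leaves x unchanged. *)
Lemma signed_sum_moments n (a : 'I_n -> R) (A : {set 'I_n}) :
  (\sum_e signed_sum a A e ^+ 2 = (2 ^ n)%:R * \sum_(i in A) a i ^+ 2) /\
  (\sum_e signed_sum a A e ^+ 4 <= (2 ^ n)%:R * (3 * (\sum_(i in A) a i ^+ 2) ^+ 2)).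
Proof.
have cardE (c : R) : \sum_(e : {ffun 'I_n -> bool}) c = (2 ^ n)%:R * c.
  by rewrite sumr_const card_ffun card_bool card_ord mulr_natl.
have [m] := ubnP #|A|; elim: m A => // m IH A.
have [->|[j jA]] := set_0Vmem A.
  move=> _; rewrite big_set0 expr0n !mulr0.
  by split; rewrite big1// => e _; rewrite /signed_sum big_set0 expr0n.
rewrite -(finset.setD1K jA); set B := A :\ j.
have jB : j \notin B by rewrite !inE eqxx.
rewrite cardsU1 jB add1n ltnS => /IH[IH2 IH4].
have sq (e : {ffun 'I_n -> bool}) : ((-1) ^+ e j * a j) ^+ 2 = a j ^+ 2.
  by rewrite exprMn sqrr_sign mul1r.
have odd (f : {ffun 'I_n -> bool} -> R) c : (forall e, f (flip j e) = f e) ->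
    \sum_e f e * ((-1) ^+ e j * a j) * c = 0.
  move=> fE; rewrite -mulr_suml; under eq_bigr do rewrite mulrA.
  by rewrite -mulr_suml sum_odd_sign// !mul0r.
rewrite big_setU1//=; split.
  transitivity (\sum_e (signed_sum a B e ^+ 2 +
      signed_sum a B e * ((-1) ^+ e j * a j) * 2 + a j ^+ 2)).
    by apply: eq_bigr => e _; rewrite signed_sumU1// sqrrD sq mulr_natr.
  rewrite !big_split/= IH2 odd ?cardE; last by move=> e; exact: signed_sum_flip.
  by rewrite addr0 addrC mulrDr.
have -> : \sum_e signed_sum a (j |: B) e ^+ 4 =
  \sum_e (signed_sum a B e ^+ 4 + signed_sum a B e ^+ 3 * ((-1) ^+ e j * a j) * 4
    + 6 * a j ^+ 2 * signed_sum a B e ^+ 2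
    + signed_sum a B e * ((-1) ^+ e j * a j) * (4 * a j ^+ 2) + a j ^+ 4).
  apply: eq_bigr => e _; rewrite signed_sumU1//; have := sq e.
  move: (signed_sum a B e) (_ * a j) => x y yE.
  have -> : a j ^+ 4 = y ^+ 2 * y ^+ 2 by rewrite yE -exprD.
  by rewrite -yE; ring.
rewrite !big_split/= odd; last by move=> e; rewrite signed_sum_flip.
rewrite odd; last by move=> e; rewrite signed_sum_flip.
rewrite -mulr_sumr IH2 cardE !addr0.
move: (\sum_e _) (\sum_(i in B) _) IH4 => x y IH4.
have : 0 <= (2 ^ n)%:R :> R by [].
move: (2 ^ n)%:R IH4 => N IH4 N0.
rewrite -subr_ge0; rewrite -subr_ge0 in IH4.
have -> : N * (3 * (a j ^+ 2 + y) ^+ 2) -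
  (x + 6 * a j ^+ 2 * (N * y) + N * a j ^+ 4) =
  (N * (3 * y ^+ 2) - x) + N * (2 * a j ^+ 4) by ring.
by rewrite addr_ge0// mulr_ge0// mulr_ge0// exprn_even_ge0.
Qed.

Lemma khintchine4 n (a : 'I_n -> R) :
  \sum_(e : {ffun 'I_n -> bool}) (\sum_i (-1) ^+ e i * a i) ^+ 4 <=
  (2 ^ n)%:R * (3 * (\sum_i a i ^+ 2) ^+ 2).
Proof.
have sumT (f : 'I_n -> R) : \sum_(i in finset.setT) f i = \sum_i f i.
  by apply: eq_bigl => i; rewrite finset.in_setT.
have [_] := signed_sum_moments a finset.setT.
by rewrite /signed_sum sumT; under eq_bigr do rewrite sumT.
Qed.

End khintchine.

(** * Integrals of scalar functions *)

Section scalar_integral.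
Variables (R : realType) (k : scalar_field).
Local Notation K := (scalars R k).

Definition mk_scalar : R -> R -> K :=
  match k with RealScalars => fun a _ => a | ComplexScalars => fun a b => Complex a b end.

(** The imaginary unit exists only over the complex numbers: this factor makes
    the formulas for the imaginary parts uniform in the two cases. *)
Definition imag_coef : R := match k with RealScalars => 0 | ComplexScalars => 1 end.

Lemma re_mk a b : re_part (mk_scalar a b) = a.
Proof. by rewrite /mk_scalar; case: k. Qed.

Lemma im_mk a b : im_part (mk_scalar a b) = imag_coef * b.
Proof. by rewrite /mk_scalar /imag_coef; case: k; rewrite ?mul0r ?mul1r. Qed.

Lemma im_coef (z : K) : imag_coef * im_part z = im_part z.
Proof. by rewrite /imag_coef; case: k z => z; rewrite ?mul0r ?mul1r. Qed.

Definition conj_scalar (z : K) := mk_scalar (re_part z) (- im_part z).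

Lemma re_conj z : re_part (conj_scalar z) = re_part z.
Proof. exact: re_mk. Qed.

Lemma im_conj z : im_part (conj_scalar z) = - im_part z.
Proof. by rewrite im_mk mulrN im_coef. Qed.

Lemma modulus_conj z : modulus (conj_scalar z) = modulus z.
Proof. by rewrite !modulusE re_conj im_conj sqrrN. Qed.

Lemma modulus_sqr (z : K) : modulus z ^+ 2 = re_part z ^+ 2 + im_part z ^+ 2.
Proof. by rewrite modulusE sqr_sqrtr// addr_ge0 ?sqr_ge0. Qed.

Lemma re_mul_conj z : re_part (z * conj_scalar z) = modulus z ^+ 2.
Proof. by rewrite re_partM re_conj im_conj mulrN opprK modulus_sqr !expr2. Qed.

Lemma re_of_real (r : R) : re_part (of_real k r) = r.
Proof. by case: k. Qed.

Lemma im_of_real (r : R) : im_part (of_real k r) = 0.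
Proof. by case: k. Qed.

Lemma re_scale r (z : K) : re_part (of_real k r * z) = r * re_part z.
Proof. by rewrite re_partM re_of_real im_of_real mul0r subr0. Qed.

Lemma im_scale r (z : K) : im_part (of_real k r * z) = r * im_part z.
Proof. by rewrite im_partM re_of_real im_of_real mul0r addr0. Qed.

Lemma sign_of_real (b : bool) : (-1) ^+ b = of_real k ((-1) ^+ b : R).
Proof.
by case: b; rewrite ?expr0 ?expr1; case: k => //=; rewrite raddfN.
Qed.

Lemma re_le_modulus (z : K) : `|re_part z| <= modulus z.
Proof. by rewrite modulusE -sqrtr_sqr ler_wsqrtr// lerDl sqr_ge0. Qed.

Lemma im_le_modulus (z : K) : `|im_part z| <= modulus z.
Proof. by rewrite modulusE -sqrtr_sqr ler_wsqrtr// lerDr sqr_ge0. Qed.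

Lemma modulus_le_re_im (z : K) : modulus z <= `|re_part z| + `|im_part z|.
Proof.
rewrite -ler_sqr ?nnegrE ?modulus_ge0 ?addr_ge0//.
by rewrite modulus_sqr sqrrD !real_normK ?num_real// lerD2r lerDl mulrn_wge0// mulr_ge0.
Qed.

Context d (Om : measurableType d).
Variable mu : {measure set Om -> \bar R}.
Implicit Types f g : Om -> K^o.

Lemma scalar_measurableM f g : scalar_measurable f -> scalar_measurable g ->
  scalar_measurable (fun w => f w * g w).
Proof.
move=> [fr fi] [gr gi]; split.
  rewrite (_ : _ \o _ = ((re_part \o f) \* (re_part \o g)) \-
      ((im_part \o f) \* (im_part \o g))).
    by apply: measurable_funB; exact: measurable_funM.
  by apply/funext => w; rewrite /= re_partM.
rewrite (_ : _ \o _ = ((re_part \o f) \* (im_part \o g)) \+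
    ((im_part \o f) \* (re_part \o g))).
  by apply: measurable_funD; exact: measurable_funM.
by apply/funext => w; rewrite /= im_partM.
Qed.

Lemma scalar_measurable_of_real (r : Om -> R) : measurable_fun setT r ->
  scalar_measurable (fun w => of_real k (r w) : K^o).
Proof.
move=> mr; split.
  by rewrite (_ : _ \o _ = r)//; apply/funext => w /=; rewrite re_of_real.
by rewrite (_ : _ \o _ = cst 0)//; apply/funext => w /=; rewrite im_of_real.
Qed.

Lemma scalar_measurable_conj f : scalar_measurable f ->
  scalar_measurable (fun w => conj_scalar (f w) : K^o).
Proof.
move=> [fr fi]; split.
  by rewrite (_ : _ \o _ = re_part \o f)//; apply/funext => w /=; rewrite re_conj.
rewrite (_ : _ \o _ = fun w => - (im_part \o f) w).
  exact: measurableT_comp.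
by apply/funext => w /=; rewrite im_conj.
Qed.

Lemma scalar_measurable0 : scalar_measurable (fun _ : Om => 0 : K^o).
Proof.
by split; rewrite (_ : _ \o _ = cst 0)//; apply/funext => w /=; case: k.
Qed.

Definition sintegrable f := scalar_measurable f /\
  (\int[mu]_w (modulus (f w))%:E < +oo)%E.

Definition sint f : K := mk_scalar (\int[mu]_w re_part (f w)) (\int[mu]_w im_part (f w)).

Lemma sintegrable_re f : sintegrable f -> mu.-integrable setT (EFin \o (re_part \o f)).
Proof.
move=> [mf fI]; apply/integrableP; split.
  by apply/measurable_EFinP; exact: mf.1.
apply: le_lt_trans fI; apply: ge0_le_integral => //.
- by apply: measurableT_comp => //; apply/measurable_EFinP; exact: mf.1.
- by apply/measurable_EFinP; exact: measurable_modulus.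
- by move=> w _; rewrite /= lee_fin re_le_modulus.
Qed.

Lemma sintegrable_im f : sintegrable f -> mu.-integrable setT (EFin \o (im_part \o f)).
Proof.
move=> [mf fI]; apply/integrableP; split.
  by apply/measurable_EFinP; exact: mf.2.
apply: le_lt_trans fI; apply: ge0_le_integral => //.
- by apply: measurableT_comp => //; apply/measurable_EFinP; exact: mf.2.
- by apply/measurable_EFinP; exact: measurable_modulus.
- by move=> w _; rewrite /= lee_fin im_le_modulus.
Qed.

Lemma sintegrable0 : sintegrable (fun _ => 0).
Proof.
split; first exact: scalar_measurable0.
by under eq_integral do rewrite modulus0; rewrite integral0.
Qed.

Lemma sint0 : sint (fun _ => 0) = 0.
Proof.
have re0 : re_part (0 : K) = 0 by case: k.
have im0 : im_part (0 : K) = 0 by case: k.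
by apply: Defs.scalarP; rewrite ?re_mk ?im_mk ?re0 ?im0 Rintegral_cst// mul0r ?mulr0.
Qed.

Lemma sintegrable_lin (a : K) f g : sintegrable f -> sintegrable g ->
  sintegrable (fun w => a * f w + g w).
Proof.
move=> [mf fI] [mg gI]; split; first exact: (scalar_measurable_submod a mf mg).
have mm h : scalar_measurable h -> measurable_fun setT (fun w => modulus (h w)).
  exact: measurable_modulus.
apply: (@le_lt_trans _ _
   (\int[mu]_w (modulus a * modulus (f w) + modulus (g w))%:E)%E).
  apply: int_ae_le => //.
  - apply: mm; exact: (scalar_measurable_submod a mf mg).
  - by apply: measurable_funD; [apply: measurable_funM => //|]; exact: mm.
  - by move=> w; exact: modulus_ge0.
  - by move=> w; rewrite addr_ge0 ?mulr_ge0 ?modulus_ge0.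
  - by apply: aeW => w; rewrite (le_trans (modulusD _ _))// modulusM.
rewrite int_add//; last 4 first.
- by apply: measurable_funM => //; exact: mm.
- exact: mm.
- by move=> w; rewrite mulr_ge0 ?modulus_ge0.
- by move=> w; exact: modulus_ge0.
rewrite int_scale ?modulus_ge0//; last 2 first.
- exact: mm.
- by move=> w; exact: modulus_ge0.
by rewrite lte_add_pinfty// lte_mul_pinfty// lee_fin modulus_ge0.
Qed.

Lemma sint_lin (a : K) f g : sintegrable f -> sintegrable g ->
  sint (fun w => a * f w + g w) = a * sint f + sint g.
Proof.
move=> fI gI; have fr := sintegrable_re fI; have fi := sintegrable_im fI.
have gr := sintegrable_re gI; have gi := sintegrable_im gI.
have Z (h : Om -> R) r : mu.-integrable setT (EFin \o h) ->
    mu.-integrable setT (EFin \o (fun w => r * h w)).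
  by move=> hI; rewrite (_ : _ \o _ = fun w => r%:E * (h w)%:E)%E//; exact: integrableZl.
have B (h1 h2 : Om -> R) : mu.-integrable setT (EFin \o h1) ->
    mu.-integrable setT (EFin \o h2) ->
    mu.-integrable setT (EFin \o (fun w => h1 w - h2 w)).
  move=> h1I h2I; rewrite (_ : _ \o _ = fun w => (h1 w)%:E - (h2 w)%:E)%E//.
  exact: integrableB.
have D (h1 h2 : Om -> R) : mu.-integrable setT (EFin \o h1) ->
    mu.-integrable setT (EFin \o h2) ->
    mu.-integrable setT (EFin \o (fun w => h1 w + h2 w)).
  move=> h1I h2I; rewrite (_ : _ \o _ = fun w => (h1 w)%:E + (h2 w)%:E)%E//.
  exact: integrableD.
apply: Defs.scalarP.
  rewrite re_partD re_partM !re_mk im_mk mulrA [_ * imag_coef]mulrC im_coef.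
  transitivity (\int[mu]_w ((re_part a * re_part (f w) - im_part a * im_part (f w))
     + re_part (g w))).
    by apply: eq_Rintegral => w _; rewrite re_partD re_partM.
  rewrite RintegralD//; last by apply: B; exact: Z.
  by rewrite RintegralB//; [rewrite !RintegralZl|exact: Z..].
rewrite im_partD im_partM !im_mk re_mk.
transitivity (imag_coef * \int[mu]_w ((re_part a * im_part (f w) +
    im_part a * re_part (f w)) + im_part (g w))).
  by congr (_ * _); apply: eq_Rintegral => w _; rewrite im_partD im_partM.
rewrite RintegralD//; last by apply: D; exact: Z.
rewrite RintegralD//; [rewrite !RintegralZl//|exact: Z..].
rewrite !mulrDr [imag_coef * (im_part a * _)]mulrA im_coef.
by rewrite [imag_coef * (re_part a * _)]mulrCA.
Qed.

Lemma sint_ae f g : sintegrable f -> sintegrable g ->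
  {ae mu, forall w, f w = g w} -> sint f = sint g.
Proof.
move=> fI gI fg; rewrite /sint; congr mk_scalar; congr fine.
  apply: ae_eq_integral => //.
  - exact: measurable_int (sintegrable_re fI).
  - exact: measurable_int (sintegrable_re gI).
  - by apply: filterS fg => w -> _.
apply: ae_eq_integral => //.
- exact: measurable_int (sintegrable_im fI).
- exact: measurable_int (sintegrable_im gI).
- by apply: filterS fg => w -> _.
Qed.

(** The factor 2 comes from treating the real and the imaginary parts
    separately; it only affects the final constant. *)
Lemma sint_le f (M : R) : sintegrable f ->
  (\int[mu]_w (modulus (f w))%:E <= M%:E)%E -> modulus (sint f) <= 2 * M.
Proof.
move=> fI fM; rewrite (le_trans (modulus_le_re_im _))// re_mk im_mk.
have mf := fI.1.
have bound (h : Om -> R) : mu.-integrable setT (EFin \o h) ->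
    (forall w, `|h w| <= modulus (f w)) -> `|\int[mu]_w h w| <= M.
  move=> hI hf; have mh : measurable_fun setT h.
    exact/measurable_EFinP/(measurable_int _ hI).
  rewrite -lee_fin EFin_normr_Rintegral//.
  apply: le_trans (le_abse_integral _ _ _) _ => //; first exact: measurable_int hI.
  apply: le_trans fM; apply: int_ae_le => //.
  - exact: measurableT_comp.
  - exact: measurable_modulus.
  - by move=> w; exact: modulus_ge0.
  - exact: aeW.
rewrite mulr_natl mulr2n lerD//.
  by apply: bound; [exact: sintegrable_re|move=> w; exact: re_le_modulus].
rewrite normrM (le_trans _ (bound (im_part \o f) _ _))//.
- by rewrite ler_piMl// /imag_coef; case: k; rewrite ?normr0 ?normr1.
- exact: sintegrable_im.
- by move=> w; exact: im_le_modulus.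
Qed.

Lemma sint_sum (I : Type) (r : seq I) (a : I -> K) (f : I -> Om -> K^o) :
  (forall i, sintegrable (f i)) ->
  sintegrable (fun w => \sum_(i <- r) a i * f i w) /\
  sint (fun w => \sum_(i <- r) a i * f i w) = \sum_(i <- r) a i * sint (f i).
Proof.
move=> fI; elim: r => [|i r [IH1 IH2]].
  under eq_fun do rewrite big_nil; rewrite big_nil.
  by split; [exact: sintegrable0|exact: sint0].
under eq_fun do rewrite big_cons; rewrite big_cons -IH2.
by split; [exact: sintegrable_lin|exact: sint_lin].
Qed.

End scalar_integral.

(** Khintchine's inequality for the real and the imaginary parts. *)
Lemma sum_pow4_signed (R : realType) (k : scalar_field) n (z : 'I_n -> scalars R k) :
  \sum_i modulus (z i) ^+ 2 <= 1 ->
  \sum_(e : {ffun 'I_n -> bool}) modulus (\sum_i (-1) ^+ e i * z i) ^+ 4 <=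
  (2 ^ n)%:R * 6.
Proof.
move=> z1.
have re_sum (f : 'I_n -> scalars R k) : re_part (\sum_i f i) = \sum_i re_part (f i).
  by apply: (big_morph _ (@re_partD R k)); case: (k).
have im_sum (f : 'I_n -> scalars R k) : im_part (\sum_i f i) = \sum_i im_part (f i).
  by apply: (big_morph _ (@im_partD R k)); case: (k).
pose a i := re_part (z i); pose b i := im_part (z i).
apply: (@le_trans _ _ (\sum_(e : {ffun 'I_n -> bool})
  (2 * (\sum_i (-1) ^+ e i * a i) ^+ 4 + 2 * (\sum_i (-1) ^+ e i * b i) ^+ 4))).
  apply: ler_sum => e _.
  have pow4 (r : R) : r ^+ 4 = (r ^+ 2) ^+ 2 by rewrite -exprM.
  rewrite !pow4 modulus_sqr re_sum im_sum.
  have -> : \sum_i re_part ((-1) ^+ e i * z i) = \sum_i (-1) ^+ e i * a i.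
    by apply: eq_bigr => i _; rewrite sign_of_real re_scale.
  have -> : \sum_i im_part ((-1) ^+ e i * z i) = \sum_i (-1) ^+ e i * b i.
    by apply: eq_bigr => i _; rewrite sign_of_real im_scale.
  move: (\sum_i _) (\sum_i _) => y x; rewrite -subr_ge0.
  have -> : 2 * (x ^+ 2) ^+ 2 + 2 * (y ^+ 2) ^+ 2 - (x ^+ 2 + y ^+ 2) ^+ 2 =
    (x ^+ 2 - y ^+ 2) ^+ 2 by ring.
  exact: sqr_ge0.
rewrite big_split -!mulr_sumr/=.
have ha := khintchine4 a; have hb := khintchine4 b.
have ab1 : \sum_i a i ^+ 2 + \sum_i b i ^+ 2 <= 1.
  apply: le_trans z1; rewrite -big_split/=.
  by apply: ler_sum => i _; rewrite modulus_sqr.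
have a_ge0 : 0 <= \sum_i a i ^+ 2 by apply: sumr_ge0 => i _; exact: sqr_ge0.
have b_ge0 : 0 <= \sum_i b i ^+ 2 by apply: sumr_ge0 => i _; exact: sqr_ge0.
move: (\sum_i a i ^+ 2) (\sum_i b i ^+ 2) ha hb ab1 a_ge0 b_ge0 => x y.
move: (\sum_e _) (\sum_e _) => u v hu hv xy x0 y0.
have N0 : 0 <= (2 ^ n)%:R :> R by [].
move: (2 ^ n)%:R N0 hu hv => N N0 hu hv.
have : x ^+ 2 + y ^+ 2 <= 1.
  have := mulr_ge0 x0 y0; nra.
move=> /(ler_wpM2l N0); nra.
Qed.

(** * Factorization through a multiplication operator on L_2 *)

Section l2_factorization.
Context d (Om : measurableType d) (R : realType) (k : scalar_field).
Variables (mu : {measure set Om -> \bar R}) (p : R) (p0 : 0 < p) (p1 : p < 1).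
Variable X : quasiNormedModType R k.
Local Notation Lp := (Lp_space k mu p0).
Variable T : bounded_op X Lp.

(** The operator T factors through L_2 as the bounded map x |-> phi x followed
    by the multiplication by w0^((2-p)/p), which is in L_t for 1/t = 1/p - 1/2
    because (2-p)/p = 2/t.  Using w0 = v^(t/2) rather than v makes w0^2 the
    density of a subprobability. *)
Record l2_factor (c : R) (phi : X -> Om -> (scalars R k)^o) (w0 : Om -> R) := {
  l2f_mweight : measurable_fun setT w0 ;
  l2f_weight_ge0 : forall w, 0 <= w0 w ;
  l2f_weight_int : (\int[mu]_w (w0 w ^+ 2)%:E <= 1)%E ;
  l2f_mphi : forall x, scalar_measurable (phi x) ;
  l2f_phi_int : forall x,
    (\int[mu]_w (modulus (phi x w) ^+ 2)%:E <= ((c * qnorm x) ^+ 2)%:E)%E ;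
  l2f_lin : forall (a : scalars R k) x y,
    {ae mu, forall w, phi (a *: x + y) w = a * phi x w + phi y w} ;
  l2f_abs : forall x, {ae mu, forall w,
    absval (T x) w = w0 w `^ ((2 - p) / p) * modulus (phi x w)} }.

(** With v from Maurey's theorem, phi x = T x / v is well defined
    because T x vanishes almost everywhere where v does. *)
Lemma two_convex_l2_factor (c : R) : 0 < c -> two_convex T c ->
  exists phi w0, l2_factor c phi w0.
Proof.
move=> c0 Tc; pose t := (p^-1 - 2^-1)^-1.
have tE : t^-1 = p^-1 - 2^-1 by rewrite /t invrK.
have [v [mv v0 vI vT]] := two_convex_factor p1 tE c0 Tc.
have pN0 : p != 0 by rewrite gt_eqF.
have p2N0 : 2 - p != 0 by rewrite gt_eqF// subr_gt0 (lt_trans p1)// ltr1n.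
have {}tE : t = 2 * p / (2 - p).
  by rewrite -[t]invrK tE; field; rewrite pN0 p2N0.
have mw : measurable_fun setT (fun w => v w `^ (t / 2)).
  exact: (measurableT_comp (measurable_powR _) mv).
have mvV : measurable_fun setT (fun w => (v w)^-1) by exact: measurable_invr.
exists (fun x w => of_real k (v w)^-1 * Lp_repr (T x) w), (fun w => v w `^ (t / 2)).
have absE x w : modulus (of_real k (v w)^-1 * Lp_repr (T x) w) = (v w)^-1 * absval (T x) w.
  by rewrite modulusM modulus_of_real ger0_norm ?invr_ge0.
split => //.
- by move=> w; exact: powR_ge0.
- by under eq_integral do rewrite -powR_mulrn ?powR_ge0// -powRrM divfK//.
- move=> x; apply: scalar_measurableM (scalar_measurable_repr _).
  exact: scalar_measurable_of_real.
- move=> x; apply: le_trans (vT x); apply: ge0_le_integral => //.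
  + by move=> w _; rewrite lee_fin sqr_ge0.
  + apply/measurable_EFinP; apply: measurable_funX.
    under eq_fun do rewrite absE.
    by apply: measurable_funM => //; exact: measurable_absval.
  + apply: emeasurable_funM.
      by apply/measurable_EFinP; apply: measurable_funX; exact: measurable_absval.
    apply: measurable_inve; first exact: measurable_funX.
    by move=> w; exact: sqr_ge0.
  + move=> w _; rewrite absE exprMn EFinM muleC.
    rewrite lee_wpmul2l ?lee_fin ?sqr_ge0// inver sqrf_eq0.
    by case: eqP => [->|_]; rewrite ?leey// exprVn.
- move=> a x y; rewrite linearP; apply: filterS (repr_lin a (T x) (T y)) => w ->.
  by rewrite mulrDr mulrCA.
- move=> x.
  have mI : measurable_fun setT (fun w => (absval (T x) w ^+ 2)%:E * (v w ^+ 2)%:E^-1)%E.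
    apply: emeasurable_funM.
      by apply/measurable_EFinP; apply: measurable_funX; exact: measurable_absval.
    apply: measurable_inve; first exact: measurable_funX.
    by move=> w; exact: sqr_ge0.
  have I0 w : (0 <= (absval (T x) w ^+ 2)%:E * (v w ^+ 2)%:E^-1)%E.
    by rewrite mule_ge0 ?inve_ge0 ?lee_fin ?sqr_ge0.
  apply: filterS (ae_lty mI I0 (vT x)) => w.
  rewrite absE -powRrM (_ : t / 2 * ((2 - p) / p) = 1); last first.
    by rewrite tE; field; rewrite pN0 p2N0.
  rewrite powRr1//; have [->|vN0] := eqVneq (v w) 0; last by rewrite mulVKf.
  rewrite expr0n inve0 mul0r; have [->//|aN0] := eqVneq (absval (T x) w) 0.
  by rewrite gt0_muley ?ltxx// lte_fin lt_neqAle sqr_ge0 eq_sym sqrf_eq0 aN0.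
Qed.

End l2_factorization.

(** * Functionals obtained by pairing with bounded functions *)

Lemma unit_ball_bounded (R : realType) (k : scalar_field)
    (X : quasiNormedModType R k) (f : X -> (scalars R k)^o) (M : R) : linear f ->
  (forall x, qnorm x <= 1 -> modulus (f x) <= M) -> f \in @bounded_linear R k X _.
Proof.
move=> lf fM; apply/bounded_linearP; split => //; exists M => x.
have f0 : f 0 = 0.
  by have := lf (-1) 0 0; rewrite scaler0 addr0 scaleN1r addNr.
have fZ a y : f (a *: y) = a *: f y by have := lf a y 0; rewrite f0 !addr0.
have [x0|xN0] := eqVneq (qnorm x) 0.
  by rewrite x0 (qnorm_eq0 _ x0) f0 qnorm0 mulr0.
have xp : 0 < qnorm x by rewrite lt_neqAle eq_sym xN0 qnorm_ge0.
rewrite -ler_pdivrMr// mulrC.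
have -> : (qnorm x)^-1 * qnorm (f x) = qnorm (f (of_real k (qnorm x)^-1 *: x)).
  by rewrite fZ qnormZ modulus_of_real ger0_norm ?invr_ge0 ?qnorm_ge0.
apply: fM; rewrite qnormZ modulus_of_real ger0_norm ?invr_ge0 ?qnorm_ge0//.
by rewrite mulVf.
Qed.

Section pairing.
Context d (Om : measurableType d) (R : realType) (k : scalar_field).
Variables (mu : {measure set Om -> \bar R}) (p : R) (p0 : 0 < p) (p1 : p < 1).
Variable X : quasiNormedModType R k.
Local Notation Lp := (Lp_space k mu p0).
Variable T : bounded_op X Lp.
Variables (c : R) (phi : X -> Om -> (scalars R k)^o) (w0 : Om -> R).
Hypotheses (c0 : 0 < c) (phiP : l2_factor T c phi w0).

Let mw := l2f_mweight phiP.
Let w0_ge0 := l2f_weight_ge0 phiP.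
Let mphi := l2f_mphi phiP.
Let aphi x w := modulus (phi x w).
Let aphi_ge0 x w : 0 <= aphi x w. Proof. exact: modulus_ge0. Qed.
Let maphi x : measurable_fun setT (aphi x).
Proof. exact: measurable_modulus. Qed.

Let N := opnorm T.

(** This bounds, for ||x|| <= 1, the integral of |S x| G for the measure of
    density w0^2, where S x = phi x / w0.  Truncation, G <= Q + G^2 / Q, splits
    it into an L_1 and an L_2 estimate of S x.  The L_1 norm is interpolated
    between L_p, where S has the norm of T, and L_2, where it has norm at most
    c; the hypothesis says that c is large compared with the norm of T, and the
    threshold 2 Q^2 c of the interpolation makes both contributions of order
    c / Q. *)
Lemma pairing_bound (Q : R) (G : Om -> R) x :
  0 < Q -> N `^ p * (2 * Q ^+ 2) `^ (2 - p) <= c `^ p ->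
  measurable_fun setT G -> (forall w, 0 <= G w) -> qnorm x <= 1 ->
  (\int[mu]_w (aphi x w * (w0 w * G w))%:E <=
    (c / (2 * Q))%:E * (3%:E + \int[mu]_w (w0 w ^+ 2 * G w ^+ 4)%:E))%E.
Proof.
move=> Q0 HQ mG G0 x1.
have [mwX maX] : measurable_fun setT (fun w => w0 w ^+ 2) /\
  measurable_fun setT (fun w => aphi x w ^+ 2).
  by split; exact: measurable_funX.
have mabs : measurable_fun setT (fun w => absval (T x) w `^ p).
  by apply: (measurableT_comp (measurable_powR _)); exact: measurable_absval.
have mG4 : measurable_fun setT (fun w => w0 w ^+ 2 * G w ^+ 4).
  by apply: measurable_funM => //; exact: measurable_funX.
pose M := 2 * Q ^+ 2 * c.
have M0 : 0 < M by rewrite !mulr_gt0// exprn_gt0.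
have cQ0 : 0 <= c / (2 * Q) by rewrite divr_ge0 ?mulr_ge0 ?ltW.
pose A1 := Q / M + (2 * c * Q)^-1.
pose A2 := Q * M `^ (1 - p).
have A1_ge0 : 0 <= A1.
  by rewrite addr_ge0 ?divr_ge0 ?invr_ge0 ?mulr_ge0// ltW.
have A2_ge0 : 0 <= A2 by rewrite mulr_ge0 ?powR_ge0// ltW.
apply: (@le_trans _ _ (\int[mu]_w (A1 * aphi x w ^+ 2 + A2 * absval (T x) w `^ p +
    c / (2 * Q) * (w0 w ^+ 2 * G w ^+ 4))%:E)%E).
  apply: int_ae_le.
  - by apply: measurable_funM => //; exact: measurable_funM.
  - apply: measurable_funD; last exact: measurable_funM.
    by apply: measurable_funD; exact: measurable_funM.
  - by move=> w; rewrite !mulr_ge0.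
  - move=> w; rewrite !addr_ge0// mulr_ge0 ?powR_ge0 ?sqr_ge0//.
    by rewrite mulr_ge0 ?sqr_ge0// exprn_ge0.
  apply: filterS (l2f_abs phiP x) => w Tw.
  have TwE : absval (T x) w `^ p = aphi x w `^ p * w0 w `^ (2 - p).
    rewrite Tw powRM ?powR_ge0 ?modulus_ge0// -powRrM mulrC divfK//.
    by rewrite gt_eqF.
  rewrite TwE.
  move: (aphi x w) (w0 w) (G w) (aphi_ge0 x w) (w0_ge0 w) (G0 w) => a b g a_ge0 b_ge0 g_ge0.
  have p01 : 0 < p < 1 by rewrite p0.
  have h1 := mul_le_sq_pow p01 a_ge0 b_ge0 M0.
  move: (a `^ p * b `^ (2 - p)) h1 => z h1.
  have Qh := ler_wpM2l (ltW Q0) h1.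
  have h2 : g <= Q + g ^+ 2 / Q.
    rewrite -subr_ge0.
    have -> : Q + g ^+ 2 / Q - g = ((Q - g / 2) ^+ 2 + 3 / 4 * g ^+ 2) / Q.
      by field; rewrite gt_eqF.
    by rewrite divr_ge0 ?(ltW Q0)// addr_ge0 ?sqr_ge0// mulr_ge0// sqr_ge0.
  have h3 := ler_wpM2l (mulr_ge0 a_ge0 b_ge0) h2.
  have h4 : a * b * g ^+ 2 / Q <=
    (2 * c * Q)^-1 * a ^+ 2 + c / (2 * Q) * (b ^+ 2 * g ^+ 4).
    rewrite -subr_ge0.
    have -> : (2 * c * Q)^-1 * a ^+ 2 + c / (2 * Q) * (b ^+ 2 * g ^+ 4) -
      a * b * g ^+ 2 / Q = (a - c * (b * g ^+ 2)) ^+ 2 / (2 * c * Q).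
      by field; rewrite !gt_eqF.
    by rewrite divr_ge0 ?sqr_ge0// !mulr_ge0// ltW.
  rewrite mulrA (le_trans h3)// /A1 /A2.
  have -> : a * b * (Q + g ^+ 2 / Q) = Q * (a * b) + a * b * g ^+ 2 / Q by ring.
  apply: le_trans (lerD Qh h4) _.
  by rewrite le_eqVlt; apply/orP; left; apply/eqP; ring.
rewrite int_add; last 4 first.
- by apply: measurable_funD; exact: measurable_funM.
- exact: measurable_funM.
- by move=> w; rewrite !addr_ge0// mulr_ge0 ?powR_ge0 ?sqr_ge0.
- by move=> w; apply: mulr_ge0 => //; apply: mulr_ge0; [exact: sqr_ge0|exact: exprn_ge0].
rewrite int_add; last 4 first.
- exact: measurable_funM.
- exact: measurable_funM.
- by move=> w; rewrite mulr_ge0 ?sqr_ge0.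
- by move=> w; rewrite mulr_ge0 ?powR_ge0.
rewrite !int_scale//; last 3 first.
- by move=> w; rewrite mulr_ge0 ?exprn_ge0// sqr_ge0.
- by move=> w; rewrite powR_ge0.
- by move=> w; rewrite sqr_ge0.
rewrite int_absval.
have T1 : qnorm (T x) <= N by exact: opnorm_ub.
have I2 : (\int[mu]_w (aphi x w ^+ 2)%:E <= (c ^+ 2)%:E)%E.
  apply: le_trans (l2f_phi_int phiP x) _.
  rewrite lee_fin ler_sqr ?nnegrE ?(ltW c0)// ?mulr_ge0 ?qnorm_ge0 ?(ltW c0)//.
  by rewrite ler_piMr// ltW.
set J := (\int[mu]_w (w0 w ^+ 2 * G w ^+ 4)%:E)%E.
have J0 : (0 <= J)%E.
  by apply: integral_ge0 => w _; rewrite lee_fin mulr_ge0 ?sqr_ge0// exprn_ge0.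
rewrite [leRHS]ge0_muleDr// leeD2r//.
apply: (@le_trans _ _ (A1%:E * (c ^+ 2)%:E + A2%:E * (N `^ p)%:E)%E).
  apply: leeD; rewrite lee_wpmul2l ?lee_fin//.
  by rewrite ge0_ler_powR ?nnegrE ?qnorm_ge0 ?(ltW p0)// opnorm_ge0.
rewrite -!EFinM -EFinD lee_fin.
have -> : A1 * c ^+ 2 = c / (2 * Q) * 2.
  by rewrite /A1 /M; field; rewrite !gt_eqF.
suff : A2 * N `^ p <= c / (2 * Q) by lra.
have Q20 : 0 < 2 * Q ^+ 2 by rewrite mulr_gt0// exprn_gt0.
rewrite /A2 /M powRM ?(ltW Q20) ?(ltW c0)//.
have E1 : (2 * Q ^+ 2) `^ (2 - p) = (2 * Q ^+ 2) `^ (1 - p) * (2 * Q ^+ 2).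
  rewrite -[X in _ = _ * X](powRr1 (ltW Q20)) -powRD; last first.
    by apply/implyP => _; rewrite gt_eqF.
  by congr powR; lra.
have cE : c `^ (1 - p) * c `^ p = c.
  by rewrite -powRD ?subrK ?powRr1 ?ltW//; apply/implyP => _; rewrite gt_eqF.
rewrite E1 in HQ; rewrite ler_pdivlMr ?mulr_gt0//.
rewrite -[leRHS]cE.
have -> : Q * ((2 * Q ^+ 2) `^ (1 - p) * c `^ (1 - p)) * N `^ p * (2 * Q) =
  c `^ (1 - p) * (N `^ p * ((2 * Q ^+ 2) `^ (1 - p) * (2 * Q ^+ 2))) by ring.
by rewrite ler_wpM2l// powR_ge0.
Qed.

(** The integral of this function is the value at x of the adjoint of
    S x = phi x / w0 on g, for the duality given by the density w0^2. *)
Definition pairing (g : Om -> (scalars R k)^o) x : Om -> (scalars R k)^o :=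
  fun w => phi x w * (of_real k (w0 w) * g w).

Lemma modulus_pairing g x w :
  modulus (pairing g x w) = aphi x w * (w0 w * modulus (g w)).
Proof. by rewrite /pairing !modulusM modulus_of_real ger0_norm. Qed.

Lemma scalar_measurable_pairing g x : scalar_measurable g ->
  scalar_measurable (pairing g x).
Proof.
move=> mg; apply: scalar_measurableM => //; apply: scalar_measurableM => //.
exact: scalar_measurable_of_real.
Qed.

Lemma int_pairing_le g x B : scalar_measurable g -> 0 <= B ->
  (forall w, modulus (g w) <= B) ->
  (\int[mu]_w (modulus (pairing g x w))%:E <= (B * ((c * qnorm x) ^+ 2 + 1))%:E)%E.
Proof.
move=> mg B0 gB.
have mwX : measurable_fun setT (fun w => w0 w ^+ 2) by exact: measurable_funX.
have maX : measurable_fun setT (fun w => aphi x w ^+ 2) by exact: measurable_funX.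
have sumX : measurable_fun setT (fun w => aphi x w ^+ 2 + w0 w ^+ 2).
  exact: measurable_funD.
apply: (@le_trans _ _ (\int[mu]_w (B * (aphi x w ^+ 2 + w0 w ^+ 2))%:E)%E).
  apply: int_ae_le.
  - exact: measurable_modulus (scalar_measurable_pairing _ mg).
  - exact: measurable_funM.
  - by move=> w; exact: modulus_ge0.
  - by move=> w; rewrite mulr_ge0// addr_ge0 ?sqr_ge0.
  apply: aeW => w; rewrite modulus_pairing.
  have := gB w; have := modulus_ge0 (g w); have := w0_ge0 w; have := aphi_ge0 x w.
  move: (aphi x w) (w0 w) (modulus (g w)) => a b m a_ge0 b_ge0 m0 mB.
  rewrite mulrA mulrC (@le_trans _ _ (B * (a * b)))//.
    by rewrite ler_wpM2r// mulr_ge0.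
  rewrite ler_wpM2l// -subr_ge0.
  have -> : a ^+ 2 + b ^+ 2 - a * b = (a - b / 2) ^+ 2 + 3 / 4 * b ^+ 2 by field.
  by rewrite addr_ge0 ?sqr_ge0// mulr_ge0// sqr_ge0.
rewrite int_scale//; last by move=> w; rewrite addr_ge0 ?sqr_ge0.
rewrite EFinM lee_wpmul2l ?lee_fin//.
rewrite int_add//; last 2 first.
- by move=> w; rewrite sqr_ge0.
- by move=> w; rewrite sqr_ge0.
by rewrite EFinD leeD//; [exact: (l2f_phi_int phiP)|exact: (l2f_weight_int phiP)].
Qed.

Lemma sintegrable_pairing g x B : scalar_measurable g ->
  (forall w, modulus (g w) <= B) -> sintegrable mu (pairing g x).
Proof.
move=> mg gB; split; first exact: scalar_measurable_pairing.
have gB' w : modulus (g w) <= `|B| by rewrite (le_trans (gB w))// ler_norm.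
by rewrite (le_lt_trans (int_pairing_le x mg _ gB'))// ltry.
Qed.

Lemma pairing_functional g B : scalar_measurable g ->
  (forall w, modulus (g w) <= B) ->
  exists L : dual_space X, forall x, L x = sint mu (pairing g x).
Proof.
move=> mg gB.
have I x : sintegrable mu (pairing g x) by exact: sintegrable_pairing gB.
have L_in : (fun x => sint mu (pairing g x) : (scalars R k)^o) \in
    @bounded_linear R k X _.
  apply: (@unit_ball_bounded R k X _ (2 * (`|B| * (c ^+ 2 + 1)))).
    move=> a x y; rewrite -[LHS]/(sint mu _) -sint_lin//; apply: sint_ae => //.
      exact: sintegrable_lin.
    by apply: filterS (l2f_lin phiP a x y) => w; rewrite /pairing => ->; ring.
  move=> x x1; apply: sint_le => //.
  have gB' w : modulus (g w) <= `|B| by rewrite (le_trans (gB w))// ler_norm.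
  apply: le_trans (int_pairing_le x mg _ gB') _ => //.
  rewrite lee_fin ler_wpM2l// lerD2r ler_sqr ?nnegrE ?(ltW c0)//.
    by rewrite ler_piMr// ltW.
  by rewrite mulr_ge0 ?qnorm_ge0// ltW.
by exists (BoundedOp L_in).
Qed.

(** The Rademacher sums G_e of the g i are not uniformly bounded, but their
    fourth moments are: averaging pairing_bound over e therefore bounds the mean
    norm of the signed sums of functionals. *)
Lemma signed_functional_norm n (g : 'I_n -> Om -> (scalars R k)^o) (Q : R)
    (L : 'I_n -> dual_space X) :
  0 < Q -> opnorm T `^ p * (2 * Q ^+ 2) `^ (2 - p) <= c `^ p ->
  (forall i, scalar_measurable (g i)) ->
  (forall w, \sum_i modulus (g i w) ^+ 2 <= 1) ->
  (forall i x, L i x = sint mu (pairing (g i) x)) ->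
  (2 ^ n)%:R^-1 * (\sum_(e : {ffun 'I_n -> bool})
     qnorm (\sum_i (-1) ^+ e i *: L i)) <= 9 * (c / Q).
Proof.
move=> Q0 HQ mg g1 LE.
have gi1 i w : modulus (g i w) <= 1.
  rewrite -ler_sqr ?nnegrE ?modulus_ge0// expr1n; apply: le_trans (g1 w).
  by rewrite (bigD1 i)//= lerDl sumr_ge0// => j _; rewrite sqr_ge0.
pose ge (e : {ffun 'I_n -> bool}) w : (scalars R k)^o := \sum_i (-1) ^+ e i * g i w.
have mge e : scalar_measurable (ge e).
  rewrite /ge; elim: (index_enum _) => [|i r IH].
    by under eq_fun do rewrite big_nil; exact: scalar_measurable0.
  by under eq_fun do rewrite big_cons; exact: scalar_measurable_submod.
have mG e : measurable_fun setT (fun w => w0 w ^+ 2 * modulus (ge e w) ^+ 4).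
  apply: measurable_funM; apply: measurable_funX => //.
  exact: measurable_modulus.
have G0 e w : 0 <= w0 w ^+ 2 * modulus (ge e w) ^+ 4.
  by rewrite mulr_ge0 ?sqr_ge0// exprn_ge0// modulus_ge0.
pose J e : \bar R := (\int[mu]_w (w0 w ^+ 2 * modulus (ge e w) ^+ 4)%:E)%E.
have J0 e : (0 <= J e)%E by apply: integral_ge0 => w _; rewrite lee_fin.
have Jsum : (\sum_e J e <= ((2 ^ n)%:R * 6)%:E)%E.
  rewrite /J -ge0_integral_sum//; last 2 first.
  - by move=> e; exact/measurable_EFinP.
  - by move=> e w _; rewrite lee_fin.
  apply: (@le_trans _ _ (\int[mu]_w ((2 ^ n)%:R * 6 * w0 w ^+ 2)%:E)%E).
    under eq_integral do rewrite sumEFin.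
    apply: int_ae_le.
    - by apply: measurable_sum => e; exact: mG.
    - by apply: measurable_funM => //; exact: measurable_funX.
    - by move=> w; apply: sumr_ge0 => e _.
    - by move=> w; rewrite !mulr_ge0.
    apply: aeW => w; rewrite -mulr_sumr mulrC ler_wpM2r ?sqr_ge0//.
    exact: sum_pow4_signed.
  rewrite int_scale//; last 2 first.
  - exact: measurable_funX.
  - by move=> w; exact: sqr_ge0.
  rewrite -[leRHS]mule1 lee_wpmul2l ?lee_fin ?mulr_ge0//.
  exact: (l2f_weight_int phiP).
have Jfin e : J e \is a fin_num.
  rewrite ge0_fin_numE//; apply: (@le_lt_trans _ _ (\sum_e J e)%E).
    by rewrite (bigD1 e)//= leeDl// sume_ge0.
  by rewrite (le_lt_trans Jsum)// ltry.
have normE (e : {ffun 'I_n -> bool}) :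
    qnorm (\sum_i (-1) ^+ e i *: L i) <= c / Q * (3 + fine (J e)).
  have opsum x (r : seq 'I_n) :
      bounded_op_fun (\sum_(i <- r) (-1) ^+ e i *: L i) x =
      \sum_(i <- r) (-1) ^+ e i * L i x.
    elim: r => [|i r IH]; first by rewrite !big_nil.
    by rewrite !big_cons -IH.
  apply: opnorm_le => x x1; rewrite opsum.
  have Ix i : sintegrable mu (pairing (g i) x) by exact: sintegrable_pairing (gi1 i).
  have [sI sE] := sint_sum (index_enum 'I_n) (fun i => (-1) ^+ e i) Ix.
  rewrite (_ : \sum_i _ = sint mu (pairing (ge e) x)); last first.
    transitivity (\sum_i (-1) ^+ e i * sint mu (pairing (g i) x)).
      by apply: eq_bigr => i _; rewrite LE.
    rewrite -sE; congr sint; apply/funext => w.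
    by rewrite /pairing /ge !mulr_sumr; apply: eq_bigr => i _; ring.
  have -> : c / Q * (3 + fine (J e)) = 2 * (c / (2 * Q) * (3 + fine (J e))).
    by field; rewrite gt_eqF.
  apply: sint_le.
    rewrite (_ : pairing _ _ = fun w => \sum_i (-1) ^+ e i * pairing (g i) x w)//.
    apply/funext => w.
    by rewrite /pairing /ge !mulr_sumr; apply: eq_bigr => i _; ring.
  rewrite EFinM EFinD fineK//.
  under eq_integral do rewrite modulus_pairing.
  apply: pairing_bound => //.
  - exact: measurable_modulus.
  - by move=> w; exact: modulus_ge0.
have N0 : 0 < (2 ^ n)%:R :> R by rewrite ltr0n expn_gt0.
rewrite ler_pdivrMl//.
apply: le_trans (ler_sum _ (fun e _ => normE e)) _.
rewrite -mulr_sumr big_split/= sumr_const card_ffun card_bool card_ord.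
have : \sum_e fine (J e) <= (2 ^ n)%:R * 6.
  by rewrite -lee_fin -sumEFin; under eq_bigr do rewrite fineK//.
rewrite -[3 *+ _]mulr_natl => h.
have -> : (2 ^ n)%:R * (9 * (c / Q)) = c / Q * ((2 ^ n)%:R * 3 + (2 ^ n)%:R * 6) by ring.
by rewrite ler_wpM2l ?divr_ge0 ?(ltW c0) ?(ltW Q0)// lerD2l.
Qed.

End pairing.

(** * The bootstrap *)

Definition cotype_two_with (R : realType) (k : scalar_field)
    (Z : quasiNormedModType R k) (C : R) :=
  forall (n : nat) (z : 'I_n -> Z), Num.sqrt (\sum_i qnorm (z i) ^+ 2) <=
    C * ((2 ^ n)%:R^-1 *
         \sum_(e : {ffun 'I_n -> bool}) qnorm (\sum_i (-1) ^+ e i *: z i)).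

Section bootstrap.
Context d (Om : measurableType d) (R : realType) (k : scalar_field).
Variables (mu : {measure set Om -> \bar R}) (p : R) (p0 : 0 < p) (p1 : p < 1).
Variable X : quasiNormedModType R k.
Local Notation Lp := (Lp_space k mu p0).
Variable T : bounded_op X Lp.

(** The bootstrap.  The functions g i are unimodular multiples of
    r_i |phi x_i| / S, where S^2 = sum_i |r_i phi x_i|^2, so that pairing phi x_i
    with g i and summing with weights r_i gives back the integral of S w0.
    Cotype two controls the norms of the functionals L i, hence the L_1 norm of
    S / w0 for the density w0^2, hence its L_p norm, which is that of the square
    function of T. *)
Lemma two_convex_half (c C2 Q : R) : 0 < c -> 0 < C2 ->
  cotype_two_with (dual_space X) C2 -> Q = 18 * C2 * 2 `^ p^-1 ->
  opnorm T `^ p * (2 * Q ^+ 2) `^ (2 - p) <= c `^ p ->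
  two_convex T c -> two_convex T (c / 2).
Proof.
move=> c0 C20 cot QE HQ /(two_convex_l2_factor p1 c0)[phi [w0 phiP]] s sw.
have Q0 : 0 < Q by rewrite QE !mulr_gt0// powR_gt0.
have pN0 : p != 0 by rewrite gt_eqF.
have mw := l2f_mweight phiP.
have w0_ge0 := l2f_weight_ge0 phiP.
have mphi := l2f_mphi phiP.
pose n := size s.
pose r (i : 'I_n) := (nth (0, 0) s i).1.
pose x (i : 'I_n) := (nth (0, 0) s i).2.
have sumE (F : R * X -> R) : \sum_(a <- s) F a = \sum_(i < n) F (r i, x i).
  rewrite (big_nth (0, 0)) big_mkord; apply: eq_bigr => i _.
  by rewrite /r /x -surjective_pairing.
pose S2 w := \sum_i (r i * modulus (phi (x i) w)) ^+ 2.
pose S w := Num.sqrt (S2 w).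
have S2_ge0 w : 0 <= S2 w by apply: sumr_ge0 => i _; rewrite sqr_ge0.
have S_ge0 w : 0 <= S w by exact: sqrtr_ge0.
have SE w : S w ^+ 2 = S2 w by rewrite sqr_sqrtr.
have mS : measurable_fun setT S.
  apply: measurableT_comp.
    by apply: continuous_measurable_fun; exact: sqrt_continuous.
  apply: measurable_sum => i; apply: measurable_funX.
  by apply: measurable_funM => //; exact: measurable_modulus.
pose g i w : (scalars R k)^o := of_real k (r i / S w) * conj_scalar (phi (x i) w).
have mg i : scalar_measurable (g i).
  apply: scalar_measurableM; last exact: scalar_measurable_conj.
  apply: scalar_measurable_of_real; apply: measurable_funM => //.
  exact: measurable_invr.
have modg i w : modulus (g i w) ^+ 2 = (r i * modulus (phi (x i) w)) ^+ 2 / S2 w.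
  rewrite modulusM modulus_of_real modulus_conj exprMn real_normK ?num_real//.
  by rewrite -SE !exprMn exprVn; ring.
have g1 w : \sum_i modulus (g i w) ^+ 2 <= 1.
  under eq_bigr do rewrite modg.
  rewrite -mulr_suml -/(S2 w); have [->|S2N0] := eqVneq (S2 w) 0.
    by rewrite mul0r.
  by rewrite divff.
have gi1 i w : modulus (g i w) <= 1.
  rewrite -ler_sqr ?nnegrE ?modulus_ge0// expr1n; apply: le_trans (g1 w).
  by rewrite (bigD1 i)//= lerDl sumr_ge0// => j _; rewrite sqr_ge0.
have /choice[L LE] : forall i, exists L : dual_space X,
    forall y, L y = sint mu (pairing phi w0 (g i) y).
  by move=> i; exact: (pairing_functional c0 phiP (mg i) (gi1 i)).
(* With the given Q, 2 A^p = (c / 2)^p; this is what determines Q. *)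
pose A := 9 * C2 * (c / Q).
have A0 : 0 < A by rewrite !mulr_gt0// invr_gt0.
have Lsum : \sum_i qnorm (L i) ^+ 2 <= A ^+ 2.
  have L0 : 0 <= \sum_i qnorm (L i) ^+ 2 by apply: sumr_ge0 => i _; rewrite sqr_ge0.
  rewrite -[leLHS]sqr_sqrtr// ler_sqr ?nnegrE ?sqrtr_ge0 ?(ltW A0)//.
  apply: le_trans (cot n L) _; have -> : A = C2 * (9 * (c / Q)) by rewrite /A; ring.
  rewrite ler_wpM2l ?(ltW C20)//.
  exact: (signed_functional_norm p1 c0 phiP Q0 HQ mg g1 LE).
have SwE w : S w * w0 w = \sum_i r i * re_part (pairing phi w0 (g i) (x i) w).
  transitivity (\sum_i w0 w / S w * (r i * modulus (phi (x i) w)) ^+ 2).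
    rewrite -mulr_sumr -/(S2 w) -SE; have [->|SN0] := eqVneq (S w) 0.
      by rewrite expr0n mulr0 mul0r.
    by field.
  apply: eq_bigr => i _; rewrite /pairing /g.
  have -> : phi (x i) w * (of_real k (w0 w) *
      (of_real k (r i / S w) * conj_scalar (phi (x i) w))) =
    of_real k (w0 w) * (of_real k (r i / S w) *
      (phi (x i) w * conj_scalar (phi (x i) w))) by ring.
  by rewrite !re_scale re_mul_conj; ring.
have Ii i : sintegrable mu (pairing phi w0 (g i) (x i)).
  exact: (sintegrable_pairing phiP _ (mg i) (gi1 i)).
have mSw : measurable_fun setT (fun w => S w * w0 w) by exact: measurable_funM.
have Sw0 w : 0 <= S w * w0 w by rewrite mulr_ge0.
have ISw : (\int[mu]_w (S w * w0 w)%:E <= A%:E)%E.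
  have [sI sE] := sint_sum (index_enum 'I_n) (fun i => of_real k (r i)) Ii.
  pose Fs w := \sum_(i < n) of_real k (r i) * pairing phi w0 (g i) (x i) w.
  have reE w : re_part (Fs w) = S w * w0 w.
    rewrite SwE /Fs (big_morph _ (@re_partD R k) (_ : re_part 0 = 0)); last by case: k.
    by apply: eq_bigr => i _; rewrite re_scale.
  have := sintegrable_re sI.
  rewrite (_ : EFin \o _ = fun w => (S w * w0 w)%:E); last first.
    by apply/funext => w /=; rewrite reE.
  move=> /integrable_fin_num => /(_ measurableT) fin.
  rewrite -(fineK fin) lee_fin.
  have -> : fine (\int[mu]_w (S w * w0 w)%:E)%E = \sum_i r i * re_part (L i (x i)).
    transitivity (re_part (sint mu Fs)).
      by rewrite re_mk; congr fine; apply: eq_integral => w _; rewrite reE.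
    rewrite sE (big_morph _ (@re_partD R k) (_ : re_part 0 = 0)); last by case: k.
    by apply: eq_bigr => i _; rewrite re_scale LE.
  apply: (@le_trans _ _ (\sum_i (`|r i| * qnorm (x i)) * qnorm (L i))).
    apply: ler_sum => i _; rewrite (le_trans (ler_norm _))// normrM -mulrA.
    rewrite ler_wpM2l// (le_trans (re_le_modulus _))//.
    by rewrite mulrC; exact: opnormP.
  apply: sum_mul_le => //.
  under eq_bigr do rewrite exprMn real_normK ?num_real// -exprMn.
  by rewrite -(sumE (fun a => (a.1 * qnorm a.2) ^+ 2)).
have sqE : {ae mu, forall w, sqfun T s w `^ (p / 2) = S w `^ p * w0 w `^ (2 - p)}.
  have : {ae mu, forall w, forall i : 'I_n,
      absval (T (x i)) w = w0 w `^ ((2 - p) / p) * modulus (phi (x i) w)}.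
    by apply: filter_forall => i; exact: (l2f_abs phiP).
  apply: filterS => w Tw.
  have -> : sqfun T s w = (w0 w `^ ((2 - p) / p) * S w) ^+ 2.
    rewrite /sqfun sumE exprMn SE /S2 mulr_sumr; apply: eq_bigr => i _.
    by rewrite /= Tw -exprMn; congr (_ ^+ _); ring.
  rewrite -powR_mulrn ?mulr_ge0 ?powR_ge0// -powRrM [2 * (p / 2)]mulrC divfK//.
  rewrite powRM ?powR_ge0// -powRrM mulrC; congr (_ * _ `^ _).
  by field.
have mwX : measurable_fun setT (fun w => w0 w ^+ 2) by exact: measurable_funX.
apply: (@le_trans _ _ (\int[mu]_w (A `^ p * w0 w ^+ 2 + A `^ (p - 1) * (S w * w0 w))%:E)%E).
  apply: int_ae_le.
  - apply: (measurableT_comp (measurable_powR _)); exact: measurable_sqfun.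
  - by apply: measurable_funD; exact: measurable_funM.
  - by move=> w; exact: powR_ge0.
  - by move=> w; rewrite addr_ge0 ?mulr_ge0 ?powR_ge0 ?sqr_ge0.
  apply: filterS sqE => w ->; apply: pow_mul_le => //.
  by rewrite p0.
rewrite int_add//; last 4 first.
- exact: measurable_funM.
- exact: measurable_funM.
- by move=> w; rewrite mulr_ge0 ?powR_ge0 ?sqr_ge0.
- by move=> w; rewrite mulr_ge0 ?powR_ge0.
rewrite !int_scale ?powR_ge0//; last by move=> w; rewrite sqr_ge0.
apply: (@le_trans _ _ ((A `^ p)%:E * 1 + (A `^ (p - 1))%:E * A%:E)%E).
  apply: leeD; rewrite lee_wpmul2l ?lee_fin ?powR_ge0//.
  exact: (l2f_weight_int phiP).
rewrite mule1 -EFinM -EFinD lee_fin [_ * A]mulrC mulr_powRB1 ?(ltW A0)//.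
have AE : A = (c / 2) / 2 `^ p^-1.
  rewrite /A QE; field.
  by rewrite gt_eqF ?powR_gt0// gt_eqF.
rewrite AE powRM ?invr_ge0 ?divr_ge0 ?(ltW c0) ?powR_ge0//.
rewrite -powRN -powRrM mulNr mulVf// powR_inv1//.
by move: (_ `^ p) => z; lra.
Qed.

End bootstrap.

(** * Stability of two-convexity *)

Section stability.
Context d (Om : measurableType d) (R : realType) (k : scalar_field).
Variables (mu : {measure set Om -> \bar R}) (p : R) (p0 : 0 < p) (p1 : p < 1).
Variable X : quasiNormedModType R k.
Local Notation Lp := (Lp_space k mu p0).
Implicit Types (T S D : bounded_op X Lp) (s : seq (R * X)).

Let p2 : 0 < p / 2 < 1.
Proof. by have := p0; have := p1; move=> h1 h0; apply/andP; split; lra. Qed.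

Lemma two_convex_mono T (c c' : R) : 0 <= c -> c <= c' ->
  two_convex T c -> two_convex T c'.
Proof.
move=> c0 cc' Tc s sw; rewrite (le_trans (Tc s sw))// lee_fin.
by rewrite ge0_ler_powR ?nnegrE// ?(ltW p0)// (le_trans c0).
Qed.

(** Halving the constant, as two_convex_half allows, can be repeated as long as
    the constant is at least b. *)
Lemma two_convex_apriori T (c b C2 Q : R) : 0 < C2 ->
  cotype_two_with (dual_space X) C2 -> Q = 18 * C2 * 2 `^ p^-1 ->
  0 < b -> (2 * Q ^+ 2) `^ ((2 - p) / p) * opnorm T <= b ->
  0 <= c -> two_convex T c -> two_convex T b.
Proof.
move=> C20 cot QE b0 hb c0 Tc.
have half a : b <= a -> two_convex T a -> two_convex T (a / 2).
  move=> ba; apply: (two_convex_half p1 _ C20 cot QE); first exact: lt_le_trans ba.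
  have -> : opnorm T `^ p * (2 * Q ^+ 2) `^ (2 - p) =
      ((2 * Q ^+ 2) `^ ((2 - p) / p) * opnorm T) `^ p.
    rewrite (powRM _ (powR_ge0 _ _) (opnorm_ge0 T)) -powRrM divfK ?gt_eqF//.
    by rewrite mulrC.
  rewrite ge0_ler_powR ?nnegrE ?(ltW p0)//.
  - by rewrite mulr_ge0 ?powR_ge0 ?opnorm_ge0.
  - by rewrite ltW// (lt_le_trans b0).
  - exact: le_trans ba.
have cn0 n : 0 <= c / 2 ^+ n by rewrite divr_ge0// exprn_ge0.
have iter n : two_convex T b \/ two_convex T (c / 2 ^+ n).
  elim: n => [|n [Tb|Tn]]; [by right; rewrite expr0 divr1|by left|].
  have [cb|bc] := leP (c / 2 ^+ n) b; first by left; exact: two_convex_mono Tn.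
  by right; rewrite exprSr invfM mulrA; exact: half (ltW bc) Tn.
have [n cn] : exists n, c / 2 ^+ n <= b.
  have [n hn] : exists n : nat, c / b <= n%:R.
    by exists (Num.trunc (c / b)).+1; rewrite ltW// truncnS_gt.
  exists n; rewrite ler_pdivrMr ?exprn_gt0//.
  rewrite -ler_pdivrMl// mulrC (le_trans hn)// -natrX ler_nat.
  exact/ltnW/ltn_expl.
by have [//|] := iter n; exact: two_convex_mono.
Qed.

Lemma ae_seq s (P : X -> Om -> Prop) : (forall x, {ae mu, forall w, P x w}) ->
  {ae mu, forall w, forall a, a \in s -> P a.2 w}.
Proof.
move=> aeP; elim: s => [|b s IH]; first exact: aeW.
apply: filterS2 (aeP b.2) IH => w Pb Ps a.
by rewrite inE => /orP[/eqP ->//|]; exact: Ps.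
Qed.

Lemma sqfun_dominated T S D (al : R) : 0 <= al ->
  (forall x, {ae mu, forall w,
     absval (T x) w <= al * absval (S x) w + absval (D x) w}) ->
  forall s, (\int[mu]_w (sqfun T s w `^ (p / 2))%:E <=
   ((2 * al ^+ 2) `^ (p / 2))%:E * \int[mu]_w (sqfun S s w `^ (p / 2))%:E +
   (2 `^ (p / 2))%:E * \int[mu]_w (sqfun D s w `^ (p / 2))%:E)%E.
Proof.
move=> al0 dom s.
have mpow U : measurable_fun setT (fun w => sqfun U s w `^ (p / 2)).
  by apply: (measurableT_comp (measurable_powR _)); exact: measurable_sqfun.
have pow0 U w : 0 <= sqfun U s w `^ (p / 2) by exact: powR_ge0.
rewrite -!int_scale ?powR_ge0// -int_add//; last 4 first.
- exact: measurable_funM.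
- exact: measurable_funM.
- by move=> w; rewrite mulr_ge0 ?powR_ge0.
- by move=> w; rewrite mulr_ge0 ?powR_ge0.
apply: int_ae_le => //.
- by apply: measurable_funD; exact: measurable_funM.
- by move=> w; rewrite addr_ge0 ?mulr_ge0 ?powR_ge0.
apply: filterS (ae_seq s dom) => w Pw.
have al2 : 0 <= 2 * al ^+ 2 by rewrite mulr_ge0 ?sqr_ge0.
rewrite -!powRM ?sqfun_ge0//.
apply: (@le_trans _ _ ((2 * al ^+ 2 * sqfun S s w + 2 * sqfun D s w) `^ (p / 2))).
  rewrite ge0_ler_powR ?nnegrE ?sqfun_ge0//.
  - by case/andP: p2 => /ltW.
  - by rewrite addr_ge0// mulr_ge0 ?sqfun_ge0.
  rewrite /sqfun !mulr_sumr -big_split/= big_seq [leRHS]big_seq.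
  apply: ler_sum => a /Pw; rewrite !exprMn.
  have := absval_ge0 (T a.2) w; have := absval_ge0 (S a.2) w.
  have := absval_ge0 (D a.2) w.
  move: (absval (T _) w) (absval (S _) w) (absval (D _) w) => x y z z0 y0 x0 h.
  apply: (@le_trans _ _ (a.1 ^+ 2 * (al * y + z) ^+ 2)).
    rewrite ler_wpM2l ?sqr_ge0// ler_sqr ?nnegrE//.
    by rewrite addr_ge0// mulr_ge0.
  rewrite -subr_ge0.
  have -> : 2 * al ^+ 2 * (a.1 ^+ 2 * y ^+ 2) + 2 * (a.1 ^+ 2 * z ^+ 2) -
     a.1 ^+ 2 * (al * y + z) ^+ 2 = (a.1 * (al * y - z)) ^+ 2 by ring.
  exact: sqr_ge0.
by rewrite powR_add_le ?mulr_ge0 ?sqfun_ge0 ?sqr_ge0.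
Qed.

Lemma two_convexP T (M : R) : 0 <= M ->
  (forall s, sqweight s <= 1 -> (\int[mu]_w (sqfun T s w `^ (p / 2))%:E <= M%:E)%E) ->
  two_convex T (M `^ p^-1).
Proof.
move=> M0 h s /h; rewrite -powRrM mulVf ?gt_eqF// powRr1//.
Qed.

Lemma two_convex0 : two_convex (0 : bounded_op X Lp) 0.
Proof.
move=> s _; rewrite powR0 ?gt_eqF//.
have ae0 : {ae mu, forall w, sqfun (0 : bounded_op X Lp) s w `^ (p / 2) = 0}.
  have := ae_seq s (P := fun x w => absval ((0 : bounded_op X Lp) x) w = 0)
    (fun x => absval0 k mu p0).
  apply: filterS => w Pw; rewrite (_ : sqfun _ _ _ = 0); last first.
    by rewrite /sqfun big_seq big1// => a /Pw ->; rewrite mulr0 expr0n.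
  by rewrite powR0// gt_eqF//; case/andP: p2.
apply: (@le_trans _ _ (\int[mu]_w (0 : R)%:E)%E); last by rewrite integral0.
apply: int_ae_le => //.
- by apply: (measurableT_comp (measurable_powR _)); exact: measurable_sqfun.
- by move=> w; exact: powR_ge0.
- by apply: filterS ae0 => w ->.
Qed.

Lemma two_convex_lin (a : scalars R k) S T (c1 c2 : R) : two_convex S c1 ->
  two_convex T c2 -> exists2 c, 0 <= c & two_convex (a *: S + T) c.
Proof.
move=> Sc Tc.
pose M := (2 * modulus a ^+ 2) `^ (p / 2) * c1 `^ p + 2 `^ (p / 2) * c2 `^ p.
have M0 : 0 <= M by rewrite addr_ge0// mulr_ge0 ?powR_ge0.
exists (M `^ p^-1); first exact: powR_ge0.
apply: two_convexP => // s sw.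
apply: le_trans (sqfun_dominated (S := S) (D := T) (modulus_ge0 a) _ s) _.
  move=> x; have -> : (a *: S + T) x = a *: S x + T x by [].
  apply: filterS (repr_lin a (S x) (T x)) => w E.
  rewrite /absval E.
  by rewrite (le_trans (modulusD _ _))// modulusM.
rewrite /M EFinD !EFinM leeD// lee_wpmul2l ?lee_fin ?powR_ge0//.
- exact: Sc.
- exact: Tc.
Qed.

(** For a fixed finite family this is small when the D x_i are small, whatever
    the constant of D: enough for pointwise limits. *)
Lemma int_sqfun_crude D s : (\int[mu]_w (sqfun D s w `^ (p / 2))%:E <=
  (\sum_(a <- s) `|a.1| `^ p * qnorm (D a.2) `^ p)%:E)%E.
Proof.
have mabs x : measurable_fun setT (fun w => absval (D x) w `^ p).
  by apply: (measurableT_comp (measurable_powR _)); exact: measurable_absval.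
apply: (@le_trans _ _ (\int[mu]_w (\sum_(a <- s) `|a.1| `^ p * absval (D a.2) w `^ p)%:E)%E).
  apply: int_ae_le.
  - by apply: (measurableT_comp (measurable_powR _)); exact: measurable_sqfun.
  - by apply: measurable_sum => a; exact: measurable_funM.
  - by move=> w; exact: powR_ge0.
  - by move=> w; apply: sumr_ge0 => a _; rewrite mulr_ge0 ?powR_ge0.
  apply: aeW => w; apply: le_trans (sum_powR_le _ p2 _) _.
    by move=> a; exact: sqr_ge0.
  apply: ler_sum => a _.
  have -> : (a.1 * absval (D a.2) w) ^+ 2 = (`|a.1| * absval (D a.2) w) `^ 2.
    by rewrite powR_mulrn ?mulr_ge0 ?absval_ge0// !exprMn real_normK ?num_real.
  by rewrite -powRrM [2 * _]mulrC divfK// powRM// absval_ge0.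
elim: s => [|a s IH].
  under eq_integral do rewrite big_nil; rewrite big_nil integral0//.
under eq_integral do rewrite big_cons; rewrite big_cons.
rewrite int_add//; last 4 first.
- exact: measurable_funM.
- by apply: measurable_sum => b; exact: measurable_funM.
- by move=> w; rewrite mulr_ge0 ?powR_ge0.
- by move=> w; apply: sumr_ge0 => b _; rewrite mulr_ge0 ?powR_ge0.
rewrite int_scale ?powR_ge0//; last by move=> w; exact: powR_ge0.
by rewrite int_absval EFinD EFinM leeD.
Qed.

(** The square function of T on a fixed finite family differs little from that
    of S i for i large, so that a bound common to all S i survives, up to a
    constant. *)
Lemma two_convex_net (b : R) (I : Type) (le : I -> I -> Prop)
    (S : I -> bounded_op X Lp) T : directed le ->
  (forall i, two_convex (S i) b) -> pointwise_cvg_net le S T ->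
  exists2 c, 0 <= c & two_convex T c.
Proof.
move=> [[i0] le_refl le_trans' le_dir] Sb ST.
pose M := (2 * 1 ^+ 2) `^ (p / 2) * b `^ p + 2 `^ (p / 2) * 1.
have M0 : 0 <= M by rewrite addr_ge0// mulr_ge0 ?powR_ge0.
exists (M `^ p^-1); first exact: powR_ge0.
apply: two_convexP => // s sw.
pose W := \sum_(a <- s) `|a.1| `^ p.
have W0 : 0 <= W by apply: sumr_ge0 => a _; exact: powR_ge0.
pose e := (1 + W) `^ (- p^-1).
have e0 : 0 < e by rewrite powR_gt0// ltr_wpDr.
(* Directedness gives one index for all the members of the family. *)
have [i iP] : exists i, forall j, le i j ->
    forall a, a \in s -> qnorm (S j a.2 - T a.2) < e.
  elim: (s) => [|a s' [i1 h1]]; first by exists i0.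
  have [i2 h2] := ST a.2 e e0; have [i [i1i i2i]] := le_dir i1 i2.
  exists i => j ij b'; rewrite inE => /orP[/eqP ->|bs].
    exact/h2/(le_trans' _ _ _ i2i).
  exact: h1 (le_trans' _ _ _ i1i ij) _ bs.
move: (iP i (le_refl i)) => {}iP.
pose D := S i - T.
apply: le_trans (sqfun_dominated (S := S i) (D := D) ler01 _ s) _.
  move=> x; have E : T x = (-1) *: D x + S i x by rewrite scaleN1r opprB subrK.
  have := repr_lin (-1) (D x) (S i x); rewrite -E.
  apply: filterS => w Ew; rewrite {1}/absval Ew mul1r.
  rewrite (le_trans (modulusD _ _))// modulusM addrC lerD2l.
  by rewrite (_ : modulus (-1) = 1) ?mul1r// /modulus normrN1; case: (k).
rewrite /M EFinD !EFinM leeD// lee_wpmul2l ?lee_fin ?powR_ge0//.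
  exact: Sb.
apply: le_trans (int_sqfun_crude _ _) _; rewrite lee_fin.
apply: (@le_trans _ _ (W * e `^ p)).
  rewrite /W mulr_suml big_seq [leRHS]big_seq; apply: ler_sum => a /iP h.
  rewrite ler_wpM2l ?powR_ge0// ge0_ler_powR ?nnegrE ?qnorm_ge0 ?(ltW p0) ?(ltW e0)//.
  exact: ltW.
rewrite /e -powRrM mulNr mulVf ?gt_eqF// powR_inv1 ?addr_ge0//.
by rewrite ler_pdivrMr ?mul1r ?lerDr// ltr_wpDr.
Qed.

End stability.

(** * Finite-dimensional quasi-normed spaces *)

Section finite_dimension.
Variables (R : realType) (k : scalar_field) (V : quasiNormedModType R k).
Implicit Types (y : nat -> V) (c : nat -> R).

Definition real_comb y m c : V := \sum_(j < m) of_real k (c j) *: y j.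

Lemma of_realD (a b : R) : of_real k (a + b) = of_real k a + of_real k b.
Proof. by apply: Defs.scalarP; rewrite ?re_partD ?im_partD ?re_of_real ?im_of_real ?addr0. Qed.

Lemma of_realM (a b : R) : of_real k (a * b) = of_real k a * of_real k b.
Proof. by apply: Defs.scalarP; rewrite ?re_scale ?im_scale ?re_of_real ?im_of_real ?mulr0. Qed.

Lemma of_realN (a : R) : of_real k (- a) = - of_real k a.
Proof.
apply/eqP; rewrite -subr_eq0 opprK -of_realD addNr.
by case: k.
Qed.

Lemma qnormN (z : V) : qnorm (- z) = qnorm z.
Proof.
rewrite -scaleN1r qnormZ -[-1]/(- 1) (_ : -1 = of_real k (-1)); last first.
  by rewrite of_realN; case: k.
by rewrite modulus_of_real normrN1 mul1r.
Qed.

Lemma real_combS y m c :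
  real_comb y m.+1 c = real_comb y m c + of_real k (c m) *: y m.
Proof. by rewrite /real_comb big_ord_recr. Qed.

Lemma eq_real_comb y m c c' : (forall j, (j < m)%N -> c j = c' j) ->
  real_comb y m c = real_comb y m c'.
Proof. by move=> cc; apply: eq_bigr => j _; rewrite cc. Qed.

Lemma real_comb_lin y m a c c' :
  real_comb y m (fun j => a * c j + c' j) =
  of_real k a *: real_comb y m c + real_comb y m c'.
Proof.
rewrite /real_comb scaler_sumr -big_split/=; apply: eq_bigr => j _.
by rewrite of_realD of_realM scalerDl scalerA.
Qed.

Lemma real_comb_bound y m : exists2 D : R, 0 <= D & forall c (e : R), 0 <= e ->
  (forall j, (j < m)%N -> `|c j| <= e) -> qnorm (real_comb y m c) <= D * e.
Proof.
have [C C0 hC] := @qnormD_ge0 _ _ V.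
elim: m => [|m [D D0 IH]].
  exists 0 => // c e e0 _; rewrite /real_comb big_ord0 qnorm0 mul0r//.
exists (C * (D + qnorm (y m))).
  by rewrite mulr_ge0 ?addr_ge0 ?qnorm_ge0.
move=> c e e0 ce; rewrite real_combS (le_trans (hC _ _))// -mulrA ler_wpM2l//.
rewrite mulrDl lerD//.
  by apply: IH => // j jm; apply: ce; exact: leqW.
by rewrite qnormZ modulus_of_real mulrC ler_wpM2l ?qnorm_ge0// ce.
Qed.

(** Compactness of the cube: a cluster point of the coefficients of the
    approximations gives the coefficients of z. *)
Lemma bounded_coefs_closed y m (K : R) (z : V) :
  (forall e, 0 < e -> exists c, (forall j, (j < m)%N -> `|c j| <= K) /\
     qnorm (z - real_comb y m c) < e) ->
  exists c, z = real_comb y m c.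
Proof.
move=> approx.
have [C C0 hC] := @qnormD_ge0 _ _ V.
have [D D0 hD] := real_comb_bound y m.
have /choice[u uP] : forall n : nat, exists c, (forall j, (j < m)%N -> `|c j| <= K) /\
    qnorm (z - real_comb y m c) < n.+1%:R^-1.
  by move=> n; apply: approx; rewrite invr_gt0.
pose v (n : nat) : 'rV[R]_m := \row_j u n j.
have comp : compact [set w : 'rV[R]_m | forall i, `[- K, K]%classic (w ord0 i)].
  apply: (@rV_compact _ _ (fun=> `[- K, K]%classic)) => i.
  exact: segment_compact.
have [] := comp (v @ \oo) _.
  exists 0%N => // n _ i /=; rewrite mxE in_itv/= -ler_norml.
  exact: (uP n).1.
move=> w [_ wcl].
pose c j := if insub j is Some i then w ord0 (i : 'I_m) else 0.
exists c; apply/eqP; rewrite -subr_eq0; apply/eqP/qnorm_eq0/eqP.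
rewrite eq_le qnorm_ge0 andbT; apply/ler_addgt0Pl => e e0; rewrite addr0.
pose e' := e / (C + 1) / (D + 1).
have C1 : 0 < C + 1 by rewrite ltr_wpDl.
have D1 : 0 < D + 1 by rewrite ltr_wpDl.
have e'0 : 0 < e' by rewrite !divr_gt0.
pose F := [set x | exists n, n.+1%:R^-1 < e' /\ x = v n].
have FF : (v @ \oo) F.
  have [N _ HN] := near_infty_natSinv_lt (PosNum e'0).
  by exists N => // n Nn; exists n; split => //; exact: HN.
have [_ [[n [ne ->]] [_ wn]]] := wcl F _ FF (nbhsx_ballx w e' e'0).
have -> : z - real_comb y m c =
    (z - real_comb y m (u n)) + real_comb y m (fun j => -1 * c j + u n j).
  rewrite real_comb_lin of_realN (_ : of_real k 1 = 1); last by case: (k).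
  by rewrite scaleN1r [- _ + _]addrC addrA subrK.
have d1 : qnorm (z - real_comb y m (u n)) <= e'.
  by rewrite ltW// (lt_trans (uP n).2).
have d2 : qnorm (real_comb y m (fun j => -1 * c j + u n j)) <= D * e'.
  apply: hD; first exact: ltW.
  move=> j jm; rewrite mulN1r addrC /c insubT/=.
  have := wn ord0 (Ordinal jm); rewrite /ball/= /v mxE/= distrC => /ltW.
  by [].
apply: le_trans (hC _ _) _.
apply: (@le_trans _ _ (C * ((D + 1) * e'))).
  by rewrite ler_wpM2l// mulrDl mul1r addrC lerD.
have -> : C * ((D + 1) * e') = C / (C + 1) * e.
  by rewrite /e'; field; rewrite !gt_eqF.
by rewrite ler_piMl ?(ltW e0)// ler_pdivrMr// mul1r lerDl.
Qed.

(** Boundedness of the coordinates in a finite-dimensional space; when the y j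
    are dependent, it is a suitable choice of coefficients that is bounded.  When y m is
    outside the span of the previous vectors, its distance to this span is
    positive by bounded_coefs_closed, which bounds the last coefficient.
    Real coefficients suffice, since a complex span is the real span of twice as
    many vectors. *)
Lemma bounded_coefs y m : exists2 K : R, 0 <= K & forall z,
  (exists c, z = real_comb y m c) ->
  exists2 c, z = real_comb y m c & forall j, (j < m)%N -> `|c j| <= K * qnorm z.
Proof.
have [C C0 hC] := @qnormD_ge0 _ _ V.
elim: m => [|m [K K0 IH]].
  by exists 0 => // z [c zc]; exists c.
pose ext c a j : R := if (j < m)%N then c j else a.
have extE c a : real_comb y m.+1 (ext c a) = real_comb y m c + of_real k a *: y m.
  rewrite real_combS {2}/ext ltnn; congr (_ + _).
  by apply: eq_real_comb => j jm; rewrite /ext jm.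
have [[c0 yc0]|yN] := pselect (exists c, y m = real_comb y m c).
  exists K => // z [c]; rewrite real_combS yc0 addrC -real_comb_lin => zE.
  have [|c' zc' c'K] := IH z; first by eexists; exact: zE.
  exists (ext c' 0).
    by rewrite extE zc' (_ : of_real k 0 = 0) ?scale0r ?addr0//; case: (k).
  move=> j _; rewrite /ext; case: ifP => [jm|_]; first exact: c'K.
  by rewrite normr0 mulr_ge0// qnorm_ge0.
have [dl dl0 dlP] : exists2 dl : R, 0 < dl & forall c, dl <= qnorm (y m - real_comb y m c).
  apply: contrapT => h; apply: yN.
  apply: (@bounded_coefs_closed _ _ (K * (C * (1 + qnorm (y m))))) => e e0.
  have [c cP] : exists c, qnorm (y m - real_comb y m c) < Num.min e 1.
    apply: contrapT => h'; apply: h; exists (Num.min e 1).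
      by rewrite lt_min e0 ltr01.
    by move=> c; rewrite leNgt; apply/negP => h2; apply: h'; exists c.
  have [|c' cc' c'K] := IH (real_comb y m c); first by exists c.
  move: cP; rewrite lt_min => /andP[ce c1].
  exists c'; split; last by rewrite -cc'.
  move=> j jm; rewrite (le_trans (c'K _ jm))// ler_wpM2l//.
  have -> : real_comb y m c = - (y m - real_comb y m c) + y m.
    by rewrite opprB subrK.
  by rewrite (le_trans (hC _ _))// ler_wpM2l// lerD// qnormN ltW.
exists (dl^-1 + K * (C * (1 + qnorm (y m) / dl))).
  rewrite addr_ge0 ?invr_ge0 ?(ltW dl0)// !mulr_ge0// addr_ge0// divr_ge0 ?qnorm_ge0//.
  exact: ltW.
move=> z [c zE]; rewrite real_combS in zE.
have last_le : `|c m| <= qnorm z / dl.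
  rewrite ler_pdivlMr//; have [->|cmN0] := eqVneq (c m) 0.
    by rewrite normr0 mul0r qnorm_ge0.
  have -> : z = of_real k (c m) *: (y m - real_comb y m (fun j => - (c m)^-1 * c j + 0)).
    rewrite (real_comb_lin y m _ c (fun=> 0)) of_realN scaleNr opprD opprK.
    rewrite (_ : real_comb y m (fun=> 0) = 0) ?oppr0 ?addr0; last first.
      apply: big1 => j _; rewrite (_ : of_real k 0 = 0) ?scale0r//; by case: (k).
    rewrite scalerDr scalerA -of_realM mulfV// (_ : of_real k 1 = 1); last by case: (k).
    by rewrite scale1r addrC.
  by rewrite qnormZ modulus_of_real ler_wpM2l.
have [|c' cc' c'K] := IH (real_comb y m c); first by exists c.
have rest_le : qnorm (real_comb y m c) <= C * (1 + qnorm (y m) / dl) * qnorm z.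
  have -> : real_comb y m c = z + - (of_real k (c m) *: y m) by rewrite zE addrK.
  rewrite (le_trans (hC _ _))// -mulrA ler_wpM2l// mulrDl mul1r lerD2l.
  rewrite qnormN qnormZ modulus_of_real mulrAC mulrC -mulrA.
  by rewrite ler_wpM2l ?qnorm_ge0// mulrC.
exists (ext c' (c m)); first by rewrite extE -cc'.
move=> j _; rewrite /ext mulrDl; case: ifP => [jm|_].
  rewrite ler_wpDl//; first by rewrite mulr_ge0 ?qnorm_ge0// invr_ge0 ltW.
  by rewrite (le_trans (c'K _ jm))// -mulrA ler_wpM2l.
rewrite ler_wpDr//; last by rewrite mulrC.
rewrite !mulr_ge0 ?qnorm_ge0// addr_ge0// divr_ge0 ?qnorm_ge0//.
exact: ltW.
Qed.

End finite_dimension.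

(** * Finite-rank and strongly approximable operators *)

Section finite_rank_operators.
Context d (Om : measurableType d) (R : realType) (k : scalar_field).
Variables (mu : {measure set Om -> \bar R}) (p : R) (p0 : 0 < p) (p1 : p < 1).
Variable X : quasiNormedModType R k.
Local Notation Lp := (Lp_space k mu p0).

Lemma real_span_finite n (y : 'I_n -> Lp) : exists Y : nat -> Lp,
  forall c : 'I_n -> scalars R k, exists c', \sum_i c i *: y i = real_comb Y (n + n) c'.
Proof.
pose im1 : scalars R k := mk_scalar k 0 1.
exists (fun j => if insub j is Some i then y (i : 'I_n) else
  if insub (j - n)%N is Some i then im1 *: y (i : 'I_n) else 0) => c.
exists (fun j => if insub j is Some i then re_part (c (i : 'I_n)) else
  if insub (j - n)%N is Some i then im_part (c (i : 'I_n)) else 0).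
rewrite /real_comb big_split_ord/= -big_split/=; apply: eq_bigr => i _.
rewrite (valK i) insubF ?ltnNge ?leq_addr// addKn (valK i) scalerA -scalerDl.
congr (_ *: _); apply: Defs.scalarP.
  by rewrite re_partD re_scale re_of_real re_mk mulr0 addr0.
by rewrite im_partD im_scale im_of_real im_mk mulr1 add0r mulrC im_coef.
Qed.

Lemma absval_real_comb (Y : nat -> Lp) m c : {ae mu, forall w,
  absval (real_comb Y m c) w <= \sum_(j < m) `|c j| * absval (Y j) w}.
Proof.
elim: m => [|m IH].
  rewrite /real_comb big_ord0; apply: filterS (absval0 k mu p0) => w ->.
  by rewrite big_ord0.
rewrite real_combS addrC.
apply: filterS2 IH (repr_lin (of_real k (c m)) (Y m) (real_comb Y m c)) => w IHw E.
rewrite /absval E big_ord_recr/= (le_trans (modulusD _ _))//.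
by rewrite modulusM modulus_of_real addrC; exact: lerD.
Qed.

(** Bounded coordinates give |T x| <= M ||x|| h almost everywhere, for a fixed
    function h in L_p. *)
Lemma two_convex_finite_rank (T : bounded_op X Lp) : finite_rank T ->
  exists2 c, 0 <= c & two_convex T c.
Proof.
move=> [n [y Ty]]; have [Y YP] := real_span_finite y.
set m := (n + n)%N in YP.
have [K K0 hK] := bounded_coefs Y m.
have p2 : 0 < p / 2 by rewrite divr_gt0.
pose N := opnorm T.
have N0 : 0 <= N by exact: opnorm_ge0.
pose h w := \sum_(j < m) absval (Y j) w.
have h0 w : 0 <= h w by apply: sumr_ge0 => j _; exact: absval_ge0.
have mh : measurable_fun setT h.
  by apply: measurable_sum => j; exact: measurable_absval.
have Th x : {ae mu, forall w, absval (T x) w <= K * N * qnorm x * h w}.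
  have [c Txc] := Ty x; have [c' cc'] := YP c.
  have [|e Txe eK] := hK (T x); first by exists c'; rewrite Txc.
  have := absval_real_comb Y m e; rewrite -Txe; apply: filterS => w hw.
  rewrite (le_trans hw)// /h mulr_sumr; apply: ler_sum => j _.
  rewrite ler_wpM2r ?absval_ge0// (le_trans (eK _ _))// -mulrA ler_wpM2l//.
  exact: opnormP.
pose M := (K * N) `^ p * \sum_(j < m) qnorm (Y j) `^ p.
have M0 : 0 <= M.
  by rewrite mulr_ge0 ?powR_ge0//; apply: sumr_ge0 => j _; exact: powR_ge0.
exists (M `^ p^-1); first exact: powR_ge0.
apply: two_convexP => // s sw.
have mabs x : measurable_fun setT (fun w => absval x w `^ p).
  by apply: (measurableT_comp (measurable_powR _)); exact: measurable_absval.
have mabsY : measurable_fun setT (fun w => \sum_(j < m) absval (Y j) w `^ p).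
  by apply: measurable_sum => j; exact: mabs.
apply: (@le_trans _ _ (\int[mu]_w ((K * N) `^ p * \sum_(j < m) absval (Y j) w `^ p)%:E)%E).
  apply: int_ae_le.
  - by apply: (measurableT_comp (measurable_powR _)); exact: measurable_sqfun.
  - exact: measurable_funM.
  - by move=> w; exact: powR_ge0.
  - move=> w; rewrite mulr_ge0 ?powR_ge0//.
    by apply: sumr_ge0 => j _; exact: powR_ge0.
  apply: filterS (ae_seq s Th) => w hw.
  apply: (@le_trans _ _ (((K * N * h w) ^+ 2) `^ (p / 2))).
    rewrite ge0_ler_powR ?nnegrE ?sqfun_ge0 ?sqr_ge0//; first exact: ltW.
    apply: (@le_trans _ _ ((K * N * h w) ^+ 2 * sqweight s)); last first.
      by rewrite ler_piMr// sqr_ge0.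
    rewrite /sqfun /sqweight mulr_sumr big_seq [leRHS]big_seq.
    apply: ler_sum => a /hw ha.
    have -> : (K * N * h w) ^+ 2 * (a.1 * qnorm a.2) ^+ 2 =
      a.1 ^+ 2 * (K * N * qnorm a.2 * h w) ^+ 2 by ring.
    rewrite exprMn ler_wpM2l ?sqr_ge0// ler_sqr ?nnegrE ?absval_ge0//.
    by rewrite !mulr_ge0 ?qnorm_ge0.
  rewrite -powR_mulrn ?mulr_ge0// -powRrM [2 * _]mulrC divfK//.
  rewrite powRM ?mulr_ge0// ler_wpM2l ?powR_ge0//.
  apply: sum_powR_le; first by rewrite p0.
  by move=> j; exact: absval_ge0.
rewrite int_scale ?powR_ge0//; last first.
  by move=> w; apply: sumr_ge0 => j _; exact: powR_ge0.
rewrite /M EFinM lee_wpmul2l ?lee_fin ?powR_ge0//.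
under eq_integral do rewrite -sumEFin.
rewrite ge0_integral_sum//; last 2 first.
- by move=> j; apply/measurable_EFinP; exact: mabs.
- by move=> j w _; rewrite lee_fin powR_ge0.
by under eq_bigr do rewrite int_absval; rewrite sumEFin.
Qed.

(** The a priori bound makes the constants of the members of a bounded net
    uniform; this is the only reason why the limit is two-convex. *)
Lemma strongly_approximable_two_convex (T : bounded_op X Lp) (C2 Q : R) :
  0 < C2 -> cotype_two_with (dual_space X) C2 -> Q = 18 * C2 * 2 `^ p^-1 ->
  strongly_approximable T -> exists2 c, 0 <= c & two_convex T c.
Proof.
move=> C20 cot QE Tsa.
apply: (Tsa [set U | exists2 c, 0 <= c & two_convex U c]).
split; last exact: two_convex_finite_rank.
split.
  split; first by exists 0 => //; exact: two_convex0.
  by move=> a S U [c1 _ Sc] [c2 _ Uc]; exact: two_convex_lin Sc Uc.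
move=> I le S U dir Sc [M SM] SU.
pose B := (2 * Q ^+ 2) `^ ((2 - p) / p).
apply: (two_convex_net p1 (b := B * `|M| + 1) dir _ SU) => i.
have [c c0 Sic] := Sc i.
apply: (two_convex_apriori p1 C20 cot QE _ _ c0 Sic).
  by rewrite ltr_wpDl// mulr_ge0 ?powR_ge0.
rewrite ler_wpDr// ler_wpM2l ?powR_ge0//.
exact: le_trans (SM i) (ler_norm M).
Qed.

End finite_rank_operators.

(** * The factorization theorem *)

Section weighted_norm.
Context d (Om : measurableType d) (R : realType) (k : scalar_field).
Variables (mu : {measure set Om -> \bar R}) (p : R) (p0 : 0 < p).

(** The conventions of the extended reals agree on the two sides: where v
    vanishes, both integrands are 0 or infinite according to whether q vanishes. *)
Lemma weighted_L2_le (q : Lp_space k mu p0) (v : Om -> R) (b : R) : 0 <= b ->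
  (forall w, 0 <= v w) ->
  (\int[mu]_w ((absval q w ^+ 2)%:E * (v w ^+ 2)%:E^-1) <= (b ^+ 2)%:E)%E ->
  ('N[mu]_(2%:E)[weighted_abs v (Lp_repr q)] <= b%:E)%E.
Proof.
move=> b0 v0 vb; rewrite Lnorm.unlock.
have -> : (\int[mu]_x `|weighted_abs v (Lp_repr q) x| `^ 2 =
    \int[mu]_w ((absval q w ^+ 2)%:E * (v w ^+ 2)%:E^-1))%E.
  apply: eq_integral => w _; rewrite /weighted_abs -/(absval q w).
  rewrite !inver sqrf_eq0; case: eqP => _; last first.
    rewrite -EFinM abse_EFin poweR_EFin powR_mulrn// -EFinM.
    by rewrite real_normK ?num_real// exprMn exprVn mulrC.
  have [->|aN0] := eqVneq (absval q w) 0.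
    by rewrite mule0 expr0n mul0e abse0 poweR0r.
  have ap : 0 < absval q w by rewrite lt_neqAle eq_sym aN0 absval_ge0.
  rewrite gt0_mulye ?lte_fin// gt0_muley ?lte_fin ?exprn_gt0//.
  by rewrite -[LHS]/(+oo `^ 2)%E poweRyr.
apply: le_trans (_ : _ <= (b ^+ 2)%:E `^ 2^-1)%E _.
  apply: gt0_ler_poweR; rewrite ?invr_ge0// in_itv/= ?leey ?andbT ?lee_fin ?sqr_ge0//.
  by apply: integral_ge0 => w _; rewrite mule_ge0 ?inve_ge0 ?lee_fin ?sqr_ge0.
by rewrite poweR_EFin lee_fin powR12_sqrt ?sqr_ge0// sqrtr_sqr ger0_norm.
Qed.

End weighted_norm.

Theorem theorem4p5 (R : realType) (k : scalar_field) (X : quasiBanachType R k)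
    (p t : R) (p_gt0 : 0 < p) (p_lt1 : p < 1) (t_def : t^-1 = p^-1 - 2^-1) :
  cotype_two (dual_space X) ->
  exists C : R,
    forall (Omega : ptopologicalType),
      compact [set: Omega] -> hausdorff_space Omega ->
    forall (mu : {sigma_finite_measure set (borel Omega) -> \bar R})
           (T : bounded_op X (Lp_space k mu p_gt0)),
      strongly_approximable T ->
    exists v : borel Omega -> R,
      [/\ measurable_fun [set: borel Omega] v,
          forall w, 0 <= v w,
          (\int[mu]_w (v w `^ t)%:E <= C%:E)%E
        & forall x : X,
            ('N[mu]_(2%:E)[weighted_abs v (Lp_repr (T x))]
               <= (C * qnorm T * qnorm x)%:E)%E].
Proof.
move=> [C0 cot0].
pose C2 := `|C0| + 1.
have C20 : 0 < C2 by rewrite ltr_wpDl.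
have cot : cotype_two_with (dual_space X) C2.
  move=> n z; apply: le_trans (cot0 n z) _; rewrite ler_wpM2r//.
    by rewrite mulr_ge0 ?invr_ge0//; apply: sumr_ge0 => e _; exact: qnorm_ge0.
  by rewrite (le_trans (ler_norm _))// lerDl.
pose Q := 18 * C2 * 2 `^ p^-1.
pose B := (2 * Q ^+ 2) `^ ((2 - p) / p).
have Q0 : 0 < Q by rewrite !mulr_gt0// powR_gt0.
have B0 : 0 < B by rewrite powR_gt0// mulr_gt0// exprn_gt0.
have t0 : t != 0.
  rewrite -invr_eq0 t_def subr_eq0 gt_eqF// ltf_pV2 ?posrE//.
  by rewrite (lt_trans p_lt1)// ltr1n.
exists (B + 1) => Omega _ _ mu T Tsa.
(* The a priori bound requires a positive constant; a zero operator is
   factored by v = 0. *)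
have [T0|TN0] := eqVneq (qnorm T) 0.
  exists (fun=> 0); split => //.
    under eq_integral do rewrite powR0//.
    by rewrite integral0 lee_fin addr_ge0// ltW.
  move=> x; rewrite T0 mulr0 mul0r; apply: weighted_L2_le => //.
  rewrite expr0n/=; apply: (@le_trans _ _ (\int[mu]_w cst 0%E w)%E); last first.
    by rewrite integral0.
  rewrite le_eqVlt; apply/orP; left; apply/eqP.
  apply: ge0_ae_eq_integral => //.
  - apply: emeasurable_funM; last exact: measurable_cst.
    by apply/measurable_EFinP; apply: measurable_funX; exact: measurable_absval.
  - by move=> w _; rewrite mule_ge0 ?inve_ge0 ?lee_fin ?sqr_ge0.
  have -> : T x = 0 by rewrite (qnorm_eq0 _ T0).
  by apply: filterS (absval0 k mu p_gt0) => w -> _; rewrite expr0n mul0e.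
have Tp : 0 < qnorm T by rewrite lt_neqAle eq_sym TN0 qnorm_ge0.
have [c c0 Tc] := strongly_approximable_two_convex p_lt1 C20 cot erefl Tsa.
have BT : 0 < B * opnorm T by exact: mulr_gt0.
have TB := two_convex_apriori p_lt1 C20 cot erefl BT (lexx _) c0 Tc.
have [v [mv v0 vI vT]] := two_convex_factor p_lt1 t_def BT TB.
exists v; split => //.
  by rewrite (le_trans vI)// lee_fin lerDr ltW.
move=> x; apply: (le_trans (weighted_L2_le (b := B * opnorm T * qnorm x) _ v0 (vT x))).
  by rewrite mulr_ge0 ?qnorm_ge0// ltW.
by rewrite lee_fin !ler_wpM2r ?qnorm_ge0// lerDl.
Qed.
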